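(* Let $T$ be an aperiodic measure-preserving transformation of a standard probability space $(X,\mu)$. Then $T$ is ergodic if and only if the closure $\overline{D([T]_1)}$ in $[T]_1$ of the derived group of $[T]_1$ is topologically simple.
   Context: A standard probability space $(X,\mu)$ is a standard Borel space with a non-atomic Borel probability measure. $\mathrm{Aut}(X,\mu)$ is the group of measure-preserving Borel bijections of $X$, identified when they agree almost everywhere. $T$ is ergodic if every Borel set which is a union of $T$-orbits has measure $0$ or $1$; it is aperiodic if a.e. orbit is infinite. For aperiodic $T$, $[T]=\{U\in\mathrm{Aut}(X,\mu): U(x)\in\{T^n(x):n\in\mathbb Z\}\text{ for a.e. }x\}$, and each $U\in[T]$ has a cocycle $c_U:X\to\mathbb Z$ defined by $U(x)=T^{c_U(x)}(x)$. The $\mathrm L^1$ full group is $[T]_1=\{U\in[T]:\int_X|c_U|\,d\mu<+\infty\}$, with the topology induced by the metric $\tilde d_T(U,V)=\int_X|c_U-c_V|\,d\mu$. $D(G)$ denotes the derived subgroup of a group $G$. A topological group is topologically simple if its only closed normal subgroups are the trivial one and the whole group. *)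

(* Defs.v *)
From HB Require Import structures.
From mathcomp Require Import all_boot all_order all_algebra generic_quotient.
From mathcomp Require Import all_classical all_reals all_analysis.

Set Implicit Arguments.
Unset Strict Implicit.
Unset Printing Implicit Defensive.

Import Order.TTheory GRing.Theory Num.Theory.
Import numFieldNormedType.Exports.

Local Open Scope classical_set_scope.
Local Open Scope ring_scope.

(* The sigma-algebra of X is the Borel sigma-algebra of a Polish topology,
   the topology being carried by P and transported along the bijection f. *)
Definition standard_borel (R : realType) (d : measure_display)
    (X : measurableType d) : Prop :=
  exists (P : completePseudoMetricType R) (f : X -> P),
    [/\ hausdorff_space P,
        exists2 S : set P, countable S & dense S,
        bijective f &
        forall A : set X, measurable A <->
          exists2 B : set P, <<s [set O : set P | open O] >> B & A = f @^-1` B].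

Definition non_atomic (d : measure_display) (X : measurableType d)
    (R : realType) (mu : probability X R) : Prop :=
  ~ exists A : set X,
      [/\ measurable A, (0 < mu A)%E &
          forall B : set X, measurable B -> B `<=` A ->
            mu B = 0%E \/ mu B = mu A].

(* Measurability of the inverse is part of the structure; on a standard Borel
   space it is automatic for a measurable bijection (Lusin-Souslin). *)
Record mpbij (d : measure_display) (X : measurableType d) (R : realType)
    (mu : probability X R) : Type := MpBij {
  mpfun :> X -> X;
  mpinv : X -> X;
  mpfunK : cancel mpfun mpinv;
  mpinvK : cancel mpinv mpfun;
  mpfun_measurable : measurable_fun setT mpfun;
  mpinv_measurable : measurable_fun setT mpinv;
  mpfun_preserving : forall A : set X, measurable A -> mu (mpfun @^-1` A) = mu A
}.

Section MpbijGroup.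
Context (d : measure_display) (X : measurableType d) (R : realType)
  (mu : probability X R).
Implicit Types U V W : mpbij mu.

HB.instance Definition _ := gen_eqMixin (mpbij mu).
HB.instance Definition _ := gen_choiceMixin (mpbij mu).

Lemma measurable_preimageT (f : X -> X) (A : set X) :
  measurable_fun setT f -> measurable A -> measurable (f @^-1` A).
Proof. by move=> mf mA; rewrite -[_ @^-1` _]setTI; exact: mf. Qed.

Lemma mpinv_preserving U (A : set X) :
  measurable A -> mu (mpinv U @^-1` A) = mu A.
Proof.
move=> mA; rewrite -(mpfun_preserving U); last first.
  exact: measurable_preimageT (mpinv_measurable U) mA.
by congr (mu _); apply/seteqP; split=> x /=; rewrite mpfunK.
Qed.

Lemma measurable_idfun : measurable_fun [set: X] idfun.
Proof. exact: measurable_id. Qed.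

Definition mpbij1 : mpbij mu :=
  @MpBij _ _ _ mu idfun idfun (fun=> erefl) (fun=> erefl)
    measurable_idfun measurable_idfun (fun _ _ => erefl).

Definition mpbijV U : mpbij mu :=
  @MpBij _ _ _ mu (mpinv U) U (mpinvK U) (mpfunK U)
    (mpinv_measurable U) (mpfun_measurable U) (@mpinv_preserving U).

Lemma mpbijM_preserving U V (A : set X) :
  measurable A -> mu ((U \o V) @^-1` A) = mu A.
Proof.
move=> mA; rewrite comp_preimage !mpfun_preserving//.
exact: measurable_preimageT (mpfun_measurable U) mA.
Qed.

Definition mpbijM U V : mpbij mu :=
  @MpBij _ _ _ mu (U \o V) (mpinv V \o mpinv U)
    (can_comp (mpfunK U) (mpfunK V)) (can_comp (mpinvK V) (mpinvK U))
    (measurableT_comp (mpfun_measurable U) (mpfun_measurable V))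
    (measurableT_comp (mpinv_measurable V) (mpinv_measurable U))
    (@mpbijM_preserving U V).

Lemma ae_mpbij U (P : X -> Prop) :
  {ae mu, forall x, P x} -> {ae mu, forall x, P (U x)}.
Proof.
move=> [N [mN N0 PN]]; exists (U @^-1` N); split.
- exact: measurable_preimageT (mpfun_measurable U) mN.
- by rewrite mpfun_preserving.
- by move=> x /= Px; apply: PN.
Qed.

Definition mpbij_ae_eq U V : bool := `[< {ae mu, forall x, U x = V x} >].

Lemma mpbij_ae_eq_refl : reflexive mpbij_ae_eq.
Proof. by move=> U; apply/asboolP; exact: aeW. Qed.

Lemma mpbij_ae_eq_sym : symmetric mpbij_ae_eq.
Proof.
by move=> U V; apply/asboolP/asboolP; apply: filterS => x ->.
Qed.

Lemma mpbij_ae_eq_trans : transitive mpbij_ae_eq.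
Proof.
move=> V U W /asboolP UV /asboolP VW; apply/asboolP.
by apply: filterS2 UV VW => x -> ->.
Qed.

Canonical mpbij_equiv :=
  EquivRel mpbij_ae_eq mpbij_ae_eq_refl mpbij_ae_eq_sym mpbij_ae_eq_trans.

Definition Aut : Type := {eq_quot mpbij_equiv}%qT.
HB.instance Definition _ := Choice.on Aut.
HB.instance Definition _ := EqQuotient.on Aut.

Definition aut_class (U : mpbij mu) : Aut := (\pi_Aut U)%qT.

(* The representative of a class picked by the quotient construction. *)
Definition aut_rep (u : Aut) : mpbij mu := repr u.

Lemma aut_classK u : aut_class (aut_rep u) = u.
Proof. exact: reprK. Qed.

Lemma aut_class_eq U V : aut_class U = aut_class V <-> {ae mu, forall x, U x = V x}.
Proof.
split; first by move=> /eqmodP /asboolP.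
by move=> UV; apply/eqmodP/asboolP.
Qed.

Lemma ae_aut_rep U : {ae mu, forall x, aut_rep (aut_class U) x = U x}.
Proof. by apply/aut_class_eq; rewrite aut_classK. Qed.

Definition Aut1 : Aut := aut_class mpbij1.
Definition AutV (u : Aut) : Aut := aut_class (mpbijV (aut_rep u)).
Definition AutM (u v : Aut) : Aut := aut_class (mpbijM (aut_rep u) (aut_rep v)).

Lemma AutME U V : AutM (aut_class U) (aut_class V) = aut_class (mpbijM U V).
Proof.
apply/aut_class_eq; move: (ae_mpbij V (ae_aut_rep U)) (ae_aut_rep V).
by apply: filterS2 => x /= + -> => ->.
Qed.

Lemma AutMA : associative AutM.
Proof.
move=> u v w; rewrite -(aut_classK u) -(aut_classK v) -(aut_classK w) !AutME.
by apply/aut_class_eq; exact: aeW.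
Qed.

Lemma Aut1M : left_id Aut1 AutM.
Proof.
move=> u; rewrite -(aut_classK u) AutME.
by apply/aut_class_eq; exact: aeW.
Qed.

Lemma AutM1 : right_id Aut1 AutM.
Proof.
move=> u; rewrite -(aut_classK u) AutME.
by apply/aut_class_eq; exact: aeW.
Qed.

Lemma AutVM : left_inverse Aut1 AutV AutM.
Proof.
move=> u; rewrite -[X in AutM _ X]aut_classK AutME.
by apply/aut_class_eq; apply: aeW => x; exact: mpfunK.
Qed.

Lemma AutMV : right_inverse Aut1 AutV AutM.
Proof.
move=> u; rewrite -[X in AutM X _]aut_classK AutME.
by apply/aut_class_eq; apply: aeW => x; exact: mpinvK.
Qed.

HB.instance Definition _ := isGroup.Build Aut AutMA Aut1M AutM1 AutVM AutMV.

End MpbijGroup.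

Section Transformation.
Context (d : measure_display) (X : measurableType d) (R : realType)
  (mu : probability X R).
Implicit Type T : mpbij mu.

Definition zpow T (n : int) : X -> X :=
  match n with
  | Posz k => iter k T
  | Negz k => iter k.+1 (mpinv T)
  end.

Definition zorbit T (x : X) : set X := range (fun n : int => zpow T n x).

Definition ergodic T : Prop :=
  forall A : set X, measurable A -> A = \bigcup_(x in A) zorbit T x ->
    mu A = 0%E \/ mu A = 1%E.

Definition aperiodic T : Prop := {ae mu, forall x, infinite_set (zorbit T x)}.

Definition full_group T : set (Aut mu) :=
  [set u | {ae mu, forall x, zorbit T x (aut_rep u x)}].

(* When T is aperiodic and u is in the full group of T, the integer n below is
   unique for almost every x; 0 is a junk value. Another representative
   of u gives an almost everywhere equal function. *)
Definition cocycle T (u : Aut mu) (x : X) : int :=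
  xget 0 [set n : int | aut_rep u x = zpow T n x].

Definition L1_full_group T : set (Aut mu) :=
  full_group T `&`
  [set u | (\int[mu]_x (`|cocycle T u x|%:~R)%:E < +oo)%E].

Definition L1_dist T (u v : Aut mu) : \bar R :=
  (\int[mu]_x (`|cocycle T u x - cocycle T v x|%:~R)%:E)%E.

End Transformation.

Section GroupNotions.
Local Open Scope group_scope.
Context (G : groupType).
Implicit Types H K N A : set G.

Definition is_subgroup H : Prop :=
  [/\ H 1, forall x y, H x -> H y -> H (x * y) & forall x, H x -> H x^-1].

Definition normal_subgroup N H : Prop :=
  [/\ is_subgroup N, N `<=` H & forall x y, N x -> H y -> N (x ^ y)].

Definition derived_subgroup H : set G :=
  smallest is_subgroup [set commg x y | x in H & y in H].

(* H carries the topology induced by the (extended real valued) distance dist;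
   the closure of A is taken in H. *)
Definition closure_in (R : realType) (dist : G -> G -> \bar R) H A : set G :=
  [set x | H x /\
    forall e : R, (0 < e)%R -> exists2 y, (A `&` H) y & (dist x y < e%:E)%E].

Definition closed_in (R : realType) (dist : G -> G -> \bar R) H A : Prop :=
  closure_in dist H A `<=` A.

Definition topologically_simple (R : realType) (dist : G -> G -> \bar R) H :
    Prop :=
  forall N, normal_subgroup N H -> closed_in dist H N ->
    N = [set 1] \/ N = H.

End GroupNotions.

(* Main.v *)
Require Import Defs.
From mathcomp Require Import all_boot all_order all_algebra.
From mathcomp Require Import all_classical all_reals all_analysis.
From mathcomp Require Import measurable_realfun zify ring lra.

(** The group [[T]_1] acts on [(X, mu)] with the right-invariant metric
    [int d_T(U x, V x) dmu(x)], where [d_T] is the distance along the orbits of [T]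
    ([odist]); this is the metric given by cocycles ([L1_dist_dst]). Absolute
    continuity of the integral makes the group operations continuous
    ([converges_mull], [converges_comm]), so that the closure [H] of the derived
    group [D] is a group.

    If [A] is an invariant set that is neither null nor conull, the elements
    of [H] supported in [A] form a closed normal subgroup. It is neither trivial nor
    equal to [H], because both [A] and its complement support a nontrivial
    three-cycle, and a three-cycle is a commutator of two involutions
    ([three_cycle]). So topological simplicity forces ergodicity.

    Conversely let [T] be ergodic and let [N] be a closed normal subgroup of [H]
    containing some [g] different from the identity. There is a set [A] of positive
    measure with [g A] disjoint from [A], and the classical commutator trick shows
    that [N] contains the commutators of the elements of [D] supported in [A].
    Inside [A] there is a smaller set [B] with two disjoint copies under powers of
    [T]; correcting elements by copies of their inverses shows that [N] contains the
    commutators of all elements of [[T]_1] supported in [B] ([local_commutators]).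

    The passage from [B] to an arbitrary set [S] of small measure is where
    integrability matters: a map in the full group of [T] carrying [S] into [B] need
    not be integrable. But [D] contains elements carrying all of [S] except a set
    [E] of measure as small as desired into [B] ([transport]), and an element
    [u] supported in [S] is close to the first return map of [u] to the complement
    of [E]: their distance is at most twice the integral of [d_T(x, u x)] over [E]
    ([Ldist_induced]). As [N] is closed it contains the commutators of any two
    elements supported in [S] ([small_commutators]).

    Finally [[T]_1] is generated by elements of small support
    ([small_support_generation]). Let [u'] be the first return map of [u] to the
    complement of a small set [E]; then [u' u^-1] is supported in the union
    of [E] and its image [u E], while [u'] fixes [E] pointwise. Going through a
    finite cover of [X] by small sets reduces [u] to the identity. Hence [[T]_1]
    is commutative modulo [N], that is [N] contains [D], and [N = H]
    since [N] is closed. *)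

Set Implicit Arguments.
Unset Strict Implicit.
Unset Printing Implicit Defensive.

Import Order.TTheory GRing.Theory Num.Theory.
Import numFieldNormedType.Exports.

Local Open Scope classical_set_scope.
Local Open Scope ring_scope.

(** * Orbits and the distance along orbits *)

Section Orbits.
Context (d : measure_display) (X : measurableType d) (R : realType)
  (mu : probability X R).
Implicit Types (T U V W : mpbij mu) (x y z : X) (n m : int) (k : nat).

Lemma zpowS T n x : zpow T (n + 1) x = T (zpow T n x).
Proof.
case: n => [k|[|k]]; first by rewrite /= addn1.
- by rewrite /= mpinvK.
- have -> : Negz k.+1 + 1 = Negz k by rewrite !NegzE; lia.
  by rewrite /= mpinvK.
Qed.

Lemma zpowB1 T n x : zpow T (n - 1) x = mpinv T (zpow T n x).
Proof. by rewrite -[in RHS](subrK 1 n) zpowS mpfunK. Qed.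

Lemma zpowD T m n x : zpow T (m + n) x = zpow T m (zpow T n x).
Proof.
elim/int_rect: m => [|m IH|m IH]; first by rewrite add0r.
- by rewrite [in RHS]intS [1 + _]addrC zpowS -IH -zpowS; congr (zpow T _ x); lia.
- have -> : - (m.+1)%:Z = - m%:Z - 1 by lia.
  by rewrite [in RHS]zpowB1 -IH -zpowB1; congr (zpow T _ x); lia.
Qed.

Lemma zpowNK T n : cancel (zpow T n) (zpow T (- n)).
Proof. by move=> x; rewrite -zpowD addNr. Qed.

Lemma zpowKN T n : cancel (zpow T (- n)) (zpow T n).
Proof. by move=> x; rewrite -zpowD addrN. Qed.

Fixpoint mpiter U k : mpbij mu :=
  if k is k'.+1 then mpbijM U (mpiter U k') else mpbij1 mu.

Lemma mpiterE U k x : mpiter U k x = iter k U x.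
Proof. by elim: k => //= k ->. Qed.

Lemma mpiterVE U k x : mpinv (mpiter U k) x = iter k (mpinv U) x.
Proof. by elim: k x => //= k IH x; rewrite IH -iterSr. Qed.

Definition mpz T n : mpbij mu :=
  match n with
  | Posz k => mpiter T k
  | Negz k => mpbijV (mpiter T k.+1)
  end.

Lemma mpzE T n x : mpz T n x = zpow T n x.
Proof.
case: n => k; first exact: mpiterE.
by rewrite [LHS](mpiterVE T k.+1).
Qed.

Lemma mpzVE T n x : mpinv (mpz T n) x = zpow T (- n) x.
Proof. by apply: (can_inj (mpfunK (mpz T n))); rewrite mpinvK mpzE zpowKN. Qed.

Lemma zpow_measurable T n : measurable_fun setT (zpow T n).
Proof.
have -> : zpow T n = mpz T n by apply/funext => x; rewrite mpzE.
exact: mpfun_measurable.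
Qed.

Lemma zorbit_refl T x : zorbit T x x.
Proof. by exists 0. Qed.

Lemma zorbit_zpow T n x : zorbit T x (zpow T n x).
Proof. by exists n. Qed.

Lemma zpow_inj_infinite T x : infinite_set (zorbit T x) ->
  injective (fun n => zpow T n x).
Proof.
move=> oo m n mn; apply: contrapT => nm; apply: oo.
wlog ltmn : m n mn nm / m < n.
  move=> wl; have /orP[|] := lt_total (introN eqP nm); first exact: wl.
  by apply: wl; [exact: esym|move/esym].
have [p [p0 px]] : exists p : nat, (0 < p)%N /\ zpow T p x = x.
  exists `|n - m|%N; split; first by lia.
  have -> : `|n - m|%N%:Z = - m + n by lia.
  by rewrite zpowD -mn zpowNK.
apply: (@sub_finite_set _ _ ((fun i => zpow T i%:Z x) @` `I_p)); last first.
  exact/finite_image/finite_II.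
move=> _ [k _ <-].
have {}px m' : zpow T (m' * p%:Z) x = x.
  elim/int_rect: m' => [|m' IH|m' IH]; first by rewrite mul0r.
  - by rewrite intS mulrDl mul1r zpowD IH px.
  - have -> : - m'.+1%:Z * p = - p%:Z + - m'%:Z * p by lia.
    by rewrite zpowD IH -[in LHS]px zpowNK.
have p0' : p%:Z != 0 by lia.
have [r [rE rp]] : exists r : nat, (k %% p)%Z = r /\ (r < p)%N.
  by exists `|(k %% p)%Z|%N; have := @ltz_pmod k p; have := @modz_ge0 k p p0'; lia.
by exists r => //=; rewrite [in RHS](divz_eq k p) rE addrC zpowD px.
Qed.

(** The word length along the orbit: an extended metric on the space of points
    (infinite between distinct orbits), for which the distance on the full group
    is the integral of the pointwise distance. This spares all computations
    with cocycles. *)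
Definition odist T x y : \bar R :=
  ereal_inf [set (`|n|%N%:R)%:E | n in [set n : int | zpow T n x = y]].

Lemma odist_le T n x : (odist T x (zpow T n x) <= (`|n|%N%:R)%:E)%E.
Proof. by apply: ereal_inf_lbound; exists n. Qed.

Lemma odist_ge0 T x y : (0 <= odist T x y)%E.
Proof. by apply: le_ereal_inf_tmp => _ [n _ <-]; rewrite lee_fin. Qed.

Lemma odistP T x y : (odist T x y < +oo)%E ->
  exists2 n, zpow T n x = y & odist T x y = (`|n|%N%:R)%:E.
Proof.
move=> ltoo; have [n0 n0P] : exists n, zpow T n x = y.
  apply: contrapT => no; move: ltoo.
  rewrite /odist (_ : [set n | _] = set0) ?image_set0 ?ereal_inf0 ?ltxx//.
  by apply/seteqP; split => // n /= nP; apply: no; exists n.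
have ex : exists k, `[<exists2 n, zpow T n x = y & `|n|%N = k>].
  by exists `|n0|%N; apply/asboolP; exists n0.
case: (ex_minnP ex) => k /asboolP[n nP nk] kmin; exists n => //.
apply/le_anti/andP; split; first by rewrite -nP odist_le.
apply: le_ereal_inf_tmp => _ [m mP <-]; rewrite lee_fin ler_nat nk.
by apply: kmin; apply/asboolP; exists m.
Qed.

Lemma odist_zorbit T x y : (odist T x y < +oo)%E -> zorbit T x y.
Proof. by move=> /odistP[n <- _]; exists n. Qed.

Lemma odistxx T x : odist T x x = 0%E.
Proof.
by apply/le_anti; rewrite odist_ge0 andbT; exact: (@odist_le T 0 x).
Qed.

Lemma odist_ge1 T x y : x <> y -> (1 <= odist T x y)%E.
Proof.
move=> xy; have [->|] := eqVneq (odist T x y) +oo%E; first exact: leey.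
rewrite -ltey => /odistP[n ny ->]; rewrite lee_fin ler1n lt0n absz_eq0.
by apply/eqP => n0; apply: xy; rewrite -ny n0.
Qed.

Lemma odist_sym T x y : odist T x y = odist T y x.
Proof.
wlog suff le : x y / (odist T x y <= odist T y x)%E.
  by apply/le_anti; rewrite !le.
have [->|] := eqVneq (odist T y x) +oo%E; first exact: leey.
rewrite -ltey => /odistP[n <- ->].
by rewrite -[leRHS]/(`|n|%N%:R)%:E -abszN -{2}(zpowNK T n y) odist_le.
Qed.

Lemma odist_triangle T y x z : (odist T x z <= odist T x y + odist T y z)%E.
Proof.
have [->|] := eqVneq (odist T x y) +oo%E.
  by rewrite addye ?leey// -ltNye (lt_le_trans _ (odist_ge0 T y z)).
rewrite -ltey => /odistP[n ny ->].
have [->|] := eqVneq (odist T y z) +oo%E; first by rewrite addey ?leey.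
rewrite -ltey => /odistP[m mz ->]; rewrite -mz -ny -zpowD.
apply: le_trans (odist_le _ _ _) _.
by rewrite -EFinD lee_fin -natrD ler_nat; lia.
Qed.

Lemma odist_infinite_orbit T x m n : infinite_set (zorbit T x) ->
  odist T (zpow T m x) (zpow T n x) = (`|m - n|%N%:R)%:E.
Proof.
move=> /zpow_inj_infinite inj.
have /odistP[p] : (odist T (zpow T m x) (zpow T n x) < +oo)%E.
  rewrite -[in zpow T n x](subrK m n) zpowD.
  exact: le_lt_trans (odist_le _ _ _) (ltry _).
by rewrite -zpowD => /inj <- ->; congr (_%:R)%:E; lia.
Qed.

Lemma odist_iter T U k x :
  (odist T x (iter k U x) <= \sum_(i < k) odist T (iter i U x) (U (iter i U x)))%E.
Proof.
elim: k => [|k IH]; first by rewrite big_ord0 odistxx.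
rewrite big_ord_recr /=; apply: le_trans (odist_triangle _ (iter k U x) _ _) _.
by rewrite leeD2r.
Qed.

End Orbits.

(** * Separation of points and integrals of the orbit distance *)

(** Balls around the points of a countable dense set. Separating points by
    countably many measurable sets is what the standard Borel structure is for
    here: it makes the set where two maps differ measurable, and makes a map
    that moves many points displace a set of positive measure. *)
Lemma standard_borel_separating (R : realType) (d : measure_display)
    (X : measurableType d) : standard_borel R X ->
  exists2 C : nat -> set X, (forall j, measurable (C j)) &
    forall x y, x <> y -> exists2 j, C j x & ~ C j y.
Proof.
move=> [P [f [hP [S cS dS] bf mE]]].
have /countable_injP[e einj] := cS.
(* A ball need not be open, hence the interior; its radius is doubled so that it
   still contains, in its interior, the points at distance less than
   [p.2.+1%:R^-1] from [s]. *)
pose D (p : nat * nat) : set P :=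
  \bigcup_(s in [set s | S s /\ e s = p.1]) (ball s (p.2.+1%:R^-1 *+ 2))°.
have oD p : open (D p) by apply: bigcup_open => s _; exact: open_interior.
pose C j : set X := if unpickle j is Some p then f @^-1` D p else set0.
exists C.
  move=> j; rewrite /C; case: unpickle => [p|]; last exact: measurable0.
  by apply/mE; exists (D p) => //; apply: sub_sigma_algebra; exact: oD.
move=> x y xy.
have /eqP fxy : f x <> f y by move=> /(bij_inj bf).
move: hP; rewrite ball_hausdorff => /(_ _ _ fxy)[[r1 r2]] /= /eqP rdisj.
have nxy : ~ ball (f x) r1%:num (f y).
  move=> bxy; have : set0 (f y) by rewrite -rdisj; split => //; exact: ballxx.
  by [].
have [n nr] : exists n : nat, n.+1%:R^-1 *+ 3 <= r1%:num :> R.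
  have r3 : 0 < r1%:num / 3 by exact: divr_gt0.
  have [n] := ltr_add_invr r3.
  by rewrite add0r ltr_pdivlMr// mulr_natr => /ltW nr; exists n.
have x0 : 0 < n.+1%:R^-1 :> R by rewrite invr_gt0.
have [s [xs Ss]] : (ball (f x) n.+1%:R^-1)° `&` S !=set0.
  apply: dS; last exact: open_interior.
  exists (f x); apply: nbhs_singleton; apply: nbhs_interior.
  exact: nbhsx_ballx.
have {}xs : ball s n.+1%:R^-1 (f x).
  by apply: ball_sym; exact: interior_subset xs.
exists (pickle (e s, n)); rewrite /C pickleK /=.
  exists s => //=; apply/nbhs_ballP; exists n.+1%:R^-1 => //= z.
  by rewrite mulr2n; exact: ball_triangle.
move=> [s' [Ss' es']] /interior_subset; rewrite /= (einj s' s) ?inE// => sy.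
apply: nxy; apply: le_ball nr _ _; rewrite mulrSr addrC.
by apply: ball_triangle sy; exact: ball_sym.
Qed.

Section Integrals.
Context (d : measure_display) (X : measurableType d) (R : realType)
  (mu : probability X R).
Implicit Types (T U V W : mpbij mu) (f g h : X -> X) (A B E : set X).
Local Open Scope ereal_scope.

Lemma measurable_mppre U A : measurable A -> measurable (U @^-1` A).
Proof. exact/measurable_preimageT/mpfun_measurable. Qed.

Lemma measurable_mpinvpre U A : measurable A -> measurable (mpinv U @^-1` A).
Proof. exact/measurable_preimageT/mpinv_measurable. Qed.

Lemma mpinvpreK U A : U @^-1` (mpinv U @^-1` A) = A.
Proof. by apply/seteqP; split=> x /=; rewrite mpfunK. Qed.

Lemma integral_mpbij U A (l : X -> \bar R) : measurable A ->
  measurable_fun setT l -> (forall x, 0 <= l x) ->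
  \int[mu]_(x in U @^-1` A) l (U x) = \int[mu]_(x in A) l x.
Proof.
move=> mA ml l0.
rewrite -(@ge0_integral_pushforward _ _ _ _ _ _ (mpfun_measurable U) mu A l)//.
- apply: eq_measure_integral; first exact: mpfun_measurable.
  by move=> ? B mB _; exact: mpfun_preserving.
- exact: measurable_funTS.
Qed.

Lemma integral_absolutely_continuous (l : X -> \bar R) : measurable_fun setT l ->
  (forall x, 0 <= l x) -> \int[mu]_x l x < +oo ->
  forall e : R, (0 < e)%R -> exists2 r : R, (0 < r)%R &
    forall A, measurable A -> mu A < r%:E -> \int[mu]_(x in A) l x < e%:E.
Proof.
move=> ml l0 loo e e0.
have intl : mu.-integrable setT l.
  by apply/integrableP; split => //; under eq_integral do rewrite gee0_abs//.
have [P [N pn]] := Hahn_decomposition (induced_charge (integrable_abse intl)).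
have [r [r0 re]] := charge_variation_continuous pn (dominates_induced intl) e0.
exists r => // A mA Ar; apply: le_lt_trans (re _ mA Ar).
have -> : \int[mu]_(x in A) l x = induced_charge (integrable_abse intl) A.
  by apply: eq_integral => x _ /=; rewrite gee0_abs.
exact: le_trans (lee_abs _) (abse_charge_variation pn mA).
Qed.

Section Measurability.
Hypothesis hX : standard_borel R X.

Lemma measurable_neq f g : measurable_fun setT f -> measurable_fun setT g ->
  measurable [set x | f x <> g x].
Proof.
move=> mf mg; have [C mC sepC] := standard_borel_separating hX.
rewrite (_ : [set x | _] = \bigcup_j (f @^-1` C j `\` g @^-1` C j)).
  apply: bigcupT_measurable => j; apply: measurableD; exact: measurable_preimageT.
apply/seteqP; split => x /=; first by move=> /sepC[j]; exists j.
by move=> [j _ [Cf Cg]] fg; apply: Cg; rewrite /= -fg.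
Qed.

Lemma measurable_eq f g : measurable_fun setT f -> measurable_fun setT g ->
  measurable [set x | f x = g x].
Proof.
move=> mf mg; rewrite (_ : [set x | _] = ~` [set x | f x <> g x]).
  exact/measurableC/measurable_neq.
by apply/seteqP; split => x /=; [move=> -> | move/contrapT].
Qed.

Lemma measurable_odist T f g : measurable_fun setT f -> measurable_fun setT g ->
  measurable_fun setT (fun x => odist T (f x) (g x)).
Proof.
move=> mf mg.
pose u (k : nat) x : \bar R :=
  if `[< zpow T k (f x) = g x \/ zpow T (- k%:Z) (f x) = g x >]
  then k%:R%:E else +oo.
rewrite (_ : (fun x => _) = fun x => einfs (u ^~ x) 0%N).
  apply: measurable_fun_einfs => k; apply: measurable_fun_ifT => //.
  apply: (@measurable_fun_bool _ _ _ _ true); rewrite setTI.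
  rewrite (_ : _ @^-1` _ = [set x | zpow T k (f x) = g x] `|`
                           [set x | zpow T (- k%:Z) (f x) = g x]).
    have mz n : measurable_fun setT (zpow T n \o f).
      exact: measurableT_comp (zpow_measurable T n) mf.
    apply: measurableU; first exact: (measurable_eq (mz k)).
    exact: (measurable_eq (mz (- k%:Z)%R)).
  by apply/seteqP; split => x /= /asboolP.
apply/funext => x; apply/le_anti/andP; split.
  apply: le_ereal_inf_tmp => _ [k _ <-]; rewrite /u.
  case: asboolP => [[<-|<-]|_]; last exact: leey.
    exact: odist_le.
  by apply: le_trans (odist_le _ _ _) _; rewrite abszN.
apply: le_ereal_inf_tmp => _ [n nE <-]; apply: ereal_inf_lbound.
exists `|n|%N => //; rewrite /u.
case: asboolP => // -[]; case: n nE => k kE; [by left|right].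
by rewrite -kE NegzE.
Qed.

Definition Ldist T f g : \bar R := \int[mu]_x odist T (f x) (g x).

Lemma Ldist_sym T f g : Ldist T f g = Ldist T g f.
Proof. by apply: eq_integral => x _; rewrite odist_sym. Qed.

Lemma Ldistxx T f : Ldist T f f = 0.
Proof. by apply: integral0_eq => x _; rewrite odistxx. Qed.

Lemma Ldist_triangle T f g h : measurable_fun setT f -> measurable_fun setT g ->
  measurable_fun setT h -> Ldist T f h <= Ldist T f g + Ldist T g h.
Proof.
move=> mf mg mh; rewrite /Ldist -ge0_integralD//; last 4 first.
- by move=> x _; exact: odist_ge0.
- exact: measurable_odist.
- by move=> x _; exact: odist_ge0.
- exact: measurable_odist.
apply: ge0_le_integral => //.
- by move=> x _; exact: odist_ge0.
- exact: measurable_odist.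
- by apply: emeasurable_funD; exact: measurable_odist.
- by move=> x _; exact: odist_triangle.
Qed.

Lemma Ldist_ae T f g f' g' : measurable_fun setT f -> measurable_fun setT g ->
  measurable_fun setT f' -> measurable_fun setT g' ->
  {ae mu, forall x, f x = f' x} -> {ae mu, forall x, g x = g' x} ->
  Ldist T f g = Ldist T f' g'.
Proof.
move=> mf mg mf' mg' ff' gg'; apply: ge0_ae_eq_integral => //.
- exact: measurable_odist.
- exact: measurable_odist.
- by move=> x _; exact: odist_ge0.
- by move=> x _; exact: odist_ge0.
by apply: filterS2 ff' gg' => x -> ->.
Qed.

Lemma Ldist_comp T f g U : measurable_fun setT f -> measurable_fun setT g ->
  Ldist T (f \o U) (g \o U) = Ldist T f g.
Proof.
move=> mf mg.
apply: (integral_mpbij U measurableT (measurable_odist T mf mg)) => x.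
exact: odist_ge0.
Qed.

Lemma mu_neq_le T f g : measurable_fun setT f -> measurable_fun setT g ->
  mu [set x | f x <> g x] <= Ldist T f g.
Proof.
move=> mf mg; have mfg := measurable_neq mf mg.
rewrite -[leLHS]mul1e -integral_cst//.
apply: (@le_trans _ _ (\int[mu]_(x in [set x | f x <> g x]) odist T (f x) (g x))).
  apply: ge0_le_integral => //.
  - exact/measurable_funTS/measurable_odist.
  - by move=> x /= xfg; exact: odist_ge1.
apply: ge0_subset_integral => //; first exact: measurable_odist.
by move=> x _; exact: odist_ge0.
Qed.

(** Postcomposition is not isometric, but [W \o U] and [W \o V] can be farther
    apart than [U] and [V] only by what [W] moves on the two images of the set
    where [U] and [V] differ. *)
Lemma Ldist_postcomp T U V W (E := [set x | U x <> V x]) :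
  Ldist T (W \o U) (W \o V) <= Ldist T U V +
    \int[mu]_(x in mpinv U @^-1` E) odist T x (W x) +
    \int[mu]_(x in mpinv V @^-1` E) odist T x (W x).
Proof.
have mU := mpfun_measurable U; have mV := mpfun_measurable V.
have mW := mpfun_measurable W; have mi := @measurable_idfun _ X.
have mE : measurable E by exact: measurable_neq.
have ml : measurable_fun setT (fun x => odist T x (W x)).
  exact: (measurable_odist T mi mW).
have l0 x : 0 <= odist T x (W x) by exact: odist_ge0.
have ind (Z : mpbij mu) : \int[mu]_(x in mpinv Z @^-1` E) odist T x (W x) =
             \int[mu]_x ((fun x => odist T (Z x) (W (Z x))) \_ E) x.
  rewrite -(integral_mpbij Z)// ?mpinvpreK; last exact: measurable_mpinvpre.
  by rewrite [LHS]integral_mkcond.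
have mind (Z : mpbij mu) :
    measurable_fun setT ((fun x => odist T (Z x) (W (Z x))) \_ E).
  apply/(measurable_restrictT _ mE)/measurable_funTS.
  exact: measurableT_comp ml (mpfun_measurable Z).
have ind0 (Z : mpbij mu) x : 0 <= ((fun x => odist T (Z x) (W (Z x))) \_ E) x.
  by apply: erestrict_ge0 => y _; exact: odist_ge0.
rewrite !ind /Ldist.
have mUV : measurable_fun setT (fun x => odist T (U x) (V x)).
  exact: measurable_odist.
rewrite -ge0_integralD//; last by move=> x _; exact: odist_ge0.
rewrite -ge0_integralD//; [|by move=> x _; rewrite adde_ge0// odist_ge0
  |exact: emeasurable_funD].
apply: ge0_le_integral => //.
- by move=> x _; exact: odist_ge0.
- by apply: measurable_odist; exact: measurableT_comp.
- by apply: emeasurable_funD => //; exact: emeasurable_funD.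
move=> x _; rewrite !patchE; case: ifPn => [_|]; last first.
  rewrite notin_setE /E /= => /contrapT ->.
  by rewrite odistxx adde_ge0// adde_ge0// odist_ge0.
apply: le_trans (odist_triangle _ (V x) _ _) _; rewrite leeD2r//.
apply: le_trans (odist_triangle _ (U x) _ _) _.
by rewrite odist_sym addeC leeD2r.
Qed.

End Measurability.
End Integrals.

(** * Automorphisms made of pieces of powers of an automorphism *)

Section Constructions.
Context (d : measure_display) (X : measurableType d) (R : realType)
  (mu : probability X R).
Implicit Types (T U V W : mpbij mu) (A B E F N : set X).

Lemma measurable_iterpre U k A : measurable A -> measurable (iter k U @^-1` A).
Proof.
move=> mA; have -> : iter k U = mpiter U k by apply/funext => x; rewrite mpiterE.
exact: measurable_mppre.
Qed.

(** Cutting and pasting. Countable additivity gives invariance of the measure as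
    soon as the pieces fit together bijectively, because the images of the pieces
    form a partition as well. *)
Lemma mpbij_glue (f g : X -> X) (idx : X -> nat) (V : nat -> mpbij mu) :
  cancel f g -> cancel g f -> (forall i, measurable (idx @^-1` [set i])) ->
  (forall x, f x = V (idx x) x) -> exists2 W : mpbij mu, W =1 f & mpinv W =1 g.
Proof.
move=> fK gK midx fV.
have cover (j : X -> nat) A : A = \bigcup_i (j @^-1` [set i] `&` A).
  by apply/seteqP; split=> [x Ax|x [i _ []]//]; exists (j x).
have splitE (j : X -> nat) A : (forall i, measurable (j @^-1` [set i])) ->
    measurable A -> mu A = (\sum_(i <oo) mu (j @^-1` [set i] `&` A))%E.
  move=> mj mA; rewrite {1}(cover j A) measure_bigcup//=.
  - by apply: eq_eseriesl => i; rewrite in_setT.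
  - by move=> i _; exact: measurableI.
  - apply/trivIsetP => i k _ _ /eqP ik.
    apply/seteqP; split=> // x [[/= xi _] [/= xk _]].
    by case: ik; rewrite -xi.
have gV y : mpinv (V (idx (g y))) y = g y by rewrite -{2}[y]gK fV mpfunK.
have preg i : (idx \o g) @^-1` [set i] = mpinv (V i) @^-1` (idx @^-1` [set i]).
  apply/seteqP; split=> y /=; first by move=> <-; rewrite gV.
  move=> yi; rewrite (_ : g y = mpinv (V i) y)//.
  by apply: (can_inj fK); rewrite gK fV yi mpinvK.
have midxg i : measurable ((idx \o g) @^-1` [set i]).
  by rewrite preg; exact: measurable_mpinvpre.
have fpre A i : idx @^-1` [set i] `&` f @^-1` A = idx @^-1` [set i] `&` V i @^-1` A.
  by apply/seteqP; split=> x /= [<-]; rewrite fV.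
have mf : measurable_fun setT f.
  move=> _ A mA; rewrite setTI (cover idx (f @^-1` A)); apply: bigcupT_measurable => i.
  by rewrite fpre; apply: measurableI => //; exact: measurable_mppre.
have mg : measurable_fun setT g.
  move=> _ A mA; rewrite setTI (cover (idx \o g) (g @^-1` A)).
  apply: bigcupT_measurable => i.
  rewrite (_ : _ `&` _ = mpinv (V i) @^-1` (idx @^-1` [set i] `&` A)).
    by apply: measurable_mpinvpre; exact: measurableI.
  by rewrite preimage_setI -preg; apply/seteqP; split=> y /= [<-]; rewrite gV.
have fmu A : measurable A -> mu (f @^-1` A) = mu A.
  move=> mA; have mfA := measurable_preimageT mf mA.
  rewrite (splitE idx)// [RHS](splitE (idx \o g))//.
  apply: eq_eseriesr => i _; rewrite fpre preg.
  rewrite -[RHS](mpfun_preserving (V i)) ?preimage_setI ?mpinvpreK//.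
  by apply: measurableI => //; rewrite -preg.
by exists (MpBij fK gK mf mg fmu).
Qed.

Lemma mpbij_swap U B : measurable B -> (forall x, B x -> ~ B (U x)) ->
  exists S : mpbij mu, [/\ forall x, B x -> S x = U x,
    forall x, B (mpinv U x) -> S x = mpinv U x,
    forall x, ~ B x -> ~ B (mpinv U x) -> S x = x & mpinv S =1 S].
Proof.
move=> mB BU.
pose idx x := if x \in B then 0%N else if mpinv U x \in B then 1%N else 2%N.
pose V i : mpbij mu := if i is 0 then U else if i is 1 then mpbijV U else mpbij1 mu.
pose f x := V (idx x) x.
have BV x : B (mpinv U x) -> ~ B x by move=> /BU; rewrite mpinvK.
have f0 x : B x -> f x = U x by move=> Bx; rewrite /f /idx mem_set.
have f1 x : B (mpinv U x) -> f x = mpinv U x.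
  by move=> Bx; rewrite /f /idx (mem_set Bx) memNset//; exact: BV.
have f2 x : ~ B x -> ~ B (mpinv U x) -> f x = x.
  by move=> nB nB'; rewrite /f /idx !memNset.
have fK : cancel f f.
  move=> x; have [Bx|nBx] := pselect (B x); first by rewrite (f0 _ Bx) f1 mpfunK.
  have [Bx|nBx'] := pselect (B (mpinv U x)); first by rewrite (f1 _ Bx) f0 ?mpinvK.
  by rewrite !f2.
have idx0 : idx @^-1` [set 0%N] = B.
  apply/seteqP; split=> x; rewrite /idx /=; last by move=> Bx; rewrite mem_set.
  by case: ifPn => [/set_mem//|_]; case: ifP.
have idx1 : idx @^-1` [set 1%N] = mpinv U @^-1` B.
  apply/seteqP; split=> x; rewrite /idx /=; last first.
    by move=> Bx; rewrite (mem_set Bx) memNset//; exact: BV.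
  by case: ifPn => // _; case: ifPn => [/set_mem|].
have midx i : measurable (idx @^-1` [set i]).
  case: i => [|[|[|i]]]; rewrite ?idx0 ?idx1//; first exact: measurable_mpinvpre.
    rewrite (_ : _ @^-1` _ = ~` (idx @^-1` [set 0%N] `|` idx @^-1` [set 1%N])).
      apply: measurableC; rewrite idx0 idx1; apply: measurableU => //.
      exact: measurable_mpinvpre.
    apply/seteqP; split=> x; rewrite /idx /=; last first.
      by case: ifP => _; [|case: ifP => _]; tauto.
    by move=> ->; case.
  rewrite (_ : _ @^-1` _ = set0)//; apply/seteqP; split=> // x /=.
  by rewrite /idx; case: ifP => // _; case: ifP.
have [S Sf Si] := mpbij_glue fK fK midx (fun=> erefl).
by exists S; split=> x => [/f0|/f1||]; rewrite ?Sf ?Si//; exact: f2.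
Qed.

(** Poincaré recurrence: the union [E] of the iterated preimages of [F] contains
    its own preimage, which has the same measure, and a point of [F] that never
    returns lies in the difference. *)
Lemma poincare_recurrence U F : measurable F ->
  {ae mu, forall x, F x -> exists n, F (iter n.+1 U x)}.
Proof.
move=> mF; pose E := \bigcup_n (iter n U @^-1` F).
have mE : measurable E by apply: bigcupT_measurable => n; exact: measurable_iterpre.
have mUE := measurable_mppre U mE.
have UEE : U @^-1` E `<=` E.
  by move=> x [n _ /= Fn]; exists n.+1 => //=; rewrite -iterS iterSr.
exists (E `\` U @^-1` E); split; first exact: measurableD.
- rewrite measureD//; last by rewrite -ge0_fin_numE// fin_num_measure.
  rewrite (setIidr UEE) [X in (_ - X)%E](mpfun_preserving U mE).
  by rewrite subee// fin_num_measure.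
- move=> x /= /not_implyP[Fx nF]; split; first by exists 0%N.
  by move=> [n _ /= Fn]; apply: nF; exists n; rewrite -iterS iterSr.
Qed.

Definition return_time (u : X -> X) N x : nat :=
  match pselect (N x /\ exists n, `[< N (iter n.+1 u x) >]) with
  | left ret => (ex_minn ret.2).+1
  | right _ => 0%N
  end.

Lemma return_time_out u N x : ~ N x -> return_time u N x = 0%N.
Proof. by rewrite /return_time; case: pselect => // -[]. Qed.

Lemma return_time_eq u N x n : return_time u N x = n.+1 <->
  [/\ N x, N (iter n.+1 u x) & forall i, (i < n)%N -> ~ N (iter i.+1 u x)].
Proof.
rewrite /return_time; case: pselect => [[Nx ex]|no]; last first.
  by split=> // -[Nx Nn _]; case: no; split=> //; exists n; exact/asboolP.
case: ex_minnP => m /asboolP Nm mmin; split=> [[<-]|[_ Nn nmin]].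
  split=> // i im Ni; have := mmin i; rewrite leqNgt im => /(_ _)/negP.
  by apply=> //; exact/asboolP.
have /mmin : `[< N (iter n.+1 u x) >] by exact/asboolP.
by rewrite leq_eqVlt => /orP[/eqP->//|/nmin/(_ Nm)].
Qed.

Lemma return_timeP u N x : N x -> (exists n, N (iter n.+1 u x)) ->
  exists n, return_time u N x = n.+1.
Proof.
rewrite /return_time; case: pselect => [[Nx ex] _ _|no Nx [n Nn]].
  by eexists.
by case: no; split=> //; exists n; exact/asboolP.
Qed.

Lemma iter_canD (u v : X -> X) i j x : cancel u v ->
  iter i v (iter (i + j) u x) = iter j u x.
Proof. by move=> uv; elim: i => //= i IH; rewrite -iterS iterSr /= uv. Qed.

(** The backward first return undoes the forward one: between [x] and its first
    return there is no other point of [N], in either direction. *)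
Lemma return_can (u v : X -> X) N : cancel u v ->
  (forall x, N x -> exists n, N (iter n.+1 u x)) ->
  cancel (fun x => iter (return_time u N x) u x)
         (fun x => iter (return_time v N x) v x).
Proof.
move=> uv rec x; have [Nx|nNx] := pselect (N x); last first.
  by rewrite /= (return_time_out u)//= (return_time_out v).
have [n nE] := return_timeP Nx (rec _ Nx); rewrite /= nE.
have [_ Nn nmin] := (return_time_eq u N x n).1 nE.
have back i : (i <= n.+1)%N -> iter i v (iter n.+1 u x) = iter (n.+1 - i) u x.
  by move=> /subnKC {1}<-; exact: iter_canD.
rewrite (_ : return_time v N _ = n.+1); first by rewrite back// subnn.
apply/return_time_eq; split=> // [|i ltin]; first by rewrite back// subnn.
rewrite back; last exact: leqW.
rewrite subSS -[(n - i)%N]prednK ?subn_gt0//; apply: nmin.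
by rewrite prednK ?subn_gt0// leq_subr.
Qed.

Lemma measurable_return_time U N k : measurable N ->
  measurable (return_time U N @^-1` [set k]).
Proof.
move=> mN; have mS n : measurable (return_time U N @^-1` [set n.+1]).
  rewrite (_ : _ @^-1` _ = N `&` (iter n.+1 U @^-1` N `&`
      \bigcap_(i in [set i | (i < n)%N]) (~` (iter i.+1 U @^-1` N)))).
    apply: measurableI => //; apply: measurableI; first exact: measurable_iterpre.
    by apply: bigcap_measurableType => i _; apply/measurableC/measurable_iterpre.
  apply/seteqP; split=> x /= => [/return_time_eq[]//|[Nx [Nn nmin]]].
  exact/return_time_eq.
case: k => //.
rewrite (_ : _ @^-1` _ = ~` \bigcup_n return_time U N @^-1` [set n.+1]).
  by apply: measurableC; exact: bigcupT_measurable.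
apply/seteqP; split=> x /=; first by move=> r0 [n _]; rewrite /= r0.
by case E: (return_time U N x) => [//|n] []; exists n.
Qed.

Lemma ae_invariant_core U (Q : set X) : measurable Q ->
  {ae mu, forall x, Q x} -> exists Z, [/\ measurable Z,
    {ae mu, forall x, Z x}, Z `<=` Q & forall x, Z x <-> Z (U x)].
Proof.
move=> mQ aeQ; pose Z := \bigcap_(n in [set: int]) (zpow U n @^-1` Q).
have mz n : measurable (zpow U n @^-1` Q).
  by apply: measurable_preimageT => //; exact: zpow_measurable.
have cZ : Z = \bigcap_j (if unpickle j is Some n then zpow U n @^-1` Q else setT).
  apply/seteqP; split=> x ZX; first by move=> j _; case: unpickle => // n; exact: ZX.
  by move=> n _; have := ZX (pickle n) I; rewrite pickleK.
exists Z; split.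
- by rewrite cZ; apply: bigcapT_measurable => j; case: unpickle => [n|//].
- suff : {ae mu, forall x j, if unpickle j is Some n then Q (zpow U n x) else True}.
    apply: filterS => x Hx; rewrite cZ => j _.
    by have := Hx j; case: unpickle.
  apply/ae_foralln => j; case: unpickle => [n|]; last exact: aeW.
  by have := ae_mpbij (mpz U n) aeQ; apply: filterS => x; rewrite mpzE.
- by move=> x /(_ 0 I).
- move=> x; split=> Zx n _ /=.
    by rewrite -[U x]/(zpow U 1 x) -zpowD; exact: Zx.
  by have := Zx (n - 1) I; rewrite /= -[U x]/(zpow U 1 x) -zpowD subrK.
Qed.

(** The first return map of [U] to [F], extended by the identity. Recurrence
    makes it everywhere bijective after discarding an invariant null set. *)
Lemma mpbij_induced U F : measurable F ->
  exists W : mpbij mu, [/\ forall x, ~ F x -> W x = x,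
    forall x, exists k, W x = iter k U x &
    {ae mu, forall x, F x -> exists n, [/\ W x = iter n.+1 U x, F (W x) &
      forall i, (i < n)%N -> ~ F (iter i.+1 U x)]}].
Proof.
move=> mF.
pose Q := (~` F `|` \bigcup_n iter n.+1 U @^-1` F) `&`
          (~` F `|` \bigcup_n iter n.+1 (mpbijV U) @^-1` F).
have mQ : measurable Q.
  apply: measurableI; apply: measurableU; try exact: measurableC.
    by apply: bigcupT_measurable => n; exact: measurable_iterpre.
  by apply: bigcupT_measurable => n; exact: measurable_iterpre.
have aeQ : {ae mu, forall x, Q x}.
  have := poincare_recurrence U mF; have := poincare_recurrence (mpbijV U) mF.
  apply: filterS2 => x h1 h2.
  split; (have [Fx|] := pselect (F x); last by left); right.
    by have [n] := h2 Fx; exists n.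
  by have [n] := h1 Fx; exists n.
have [Z [mZ aeZ ZQ ZU]] := ae_invariant_core U mQ aeQ.
have ZV x : Z x <-> Z (mpinv U x) by rewrite -{1}[x](mpinvK U) -ZU.
have Ziter n x : Z x <-> Z (iter n U x) by elim: n => //= n ->; exact: ZU.
have ZiterV n x : Z x <-> Z (iter n (mpinv U) x) by elim: n => //= n ->; exact: ZV.
pose N := F `&` Z; have mN : measurable N by exact: measurableI.
have rU x : N x -> exists n, N (iter n.+1 U x).
  move=> [Fx Zx]; have [[//|[n _ Fn]] _] := ZQ _ Zx.
  by exists n; split => //; exact: (Ziter n.+1 x).1.
have rV x : N x -> exists n, N (iter n.+1 (mpinv U) x).
  move=> [Fx Zx]; have [_ [//|[n _ Fn]]] := ZQ _ Zx.
  by exists n; split => //; exact: (ZiterV n.+1 x).1.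
have [W Wf _] := @mpbij_glue _ _ (return_time U N) (mpiter U)
  (return_can (mpfunK U) rU) (return_can (mpinvK U) rV)
  (fun k => measurable_return_time U k mN) (fun=> esym (mpiterE _ _ _)).
exists W; split.
- by move=> x nF; rewrite Wf return_time_out// => -[].
- by move=> x; rewrite Wf; eexists.
apply: filterS aeZ => x Zx Fx.
have [n nE] := return_timeP (conj Fx Zx : N x) (rU _ (conj Fx Zx)).
exists n; rewrite Wf nE; split=> //; have [_ [] //] := (return_time_eq _ _ _ _).1 nE.
move=> _ _ nmin i /nmin; apply: contra_not => Fi; split=> //.
exact: (Ziter i.+1 x).1.
Qed.

End Constructions.

(** * Supports and the distance on classes of automorphisms *)

Section NonmeasurableIntegrand.
Import HBNNSimple.
Local Open Scope ereal_scope.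

(** The integral of a nonnegative function is a supremum over simple functions, so
    it does not see a null set on which the function, like a cocycle, is not known
    to be measurable. *)
Lemma ge0_integral_ae_measurable (d : measure_display) (X : measurableType d)
    (R : realType) (mu : {measure set X -> \bar R}) (f g : X -> \bar R) :
  (forall x, 0 <= f x) -> (forall x, 0 <= g x) -> measurable_fun setT g ->
  {ae mu, forall x, f x = g x} -> \int[mu]_x f x = \int[mu]_x g x.
Proof.
move=> f0 g0 mg fg; apply/le_anti/andP; split.
  rewrite ge0_integralTE//; apply: ge_ereal_sup => _ [h hf <-].
  rewrite -[X in sintegral _ X](patch_setT (fun=> 0%R)) -integral_nnsfun//.
  apply: ae_ge0_le_integral => //.
  - by move=> x _; rewrite lee_fin.
  - exact/measurable_EFinP.
  - by apply: filterS fg => x <- _.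
have [N [mN N0 Nfg]] := fg.
rewrite [leLHS]ge0_integralTE//; apply: ge_ereal_sup => _ [h hg <-].
pose h' := proj_nnsfun h (measurableC mN).
have -> : sintegral mu h = sintegral mu h'.
  have sE (k : {nnsfun X >-> R}) : sintegral mu k = \int[mu]_x (k x)%:E.
    by rewrite integral_nnsfun// patch_setT.
  rewrite !sE; apply: ge0_ae_eq_integral => //.
  - exact/measurable_EFinP.
  - exact/measurable_EFinP.
  - by move=> x _; rewrite lee_fin.
  - by move=> x _; rewrite lee_fin.
  exists N; split => // x /=; apply: contra_notP => xN _.
  by rewrite mindicE mem_set//= mulr1.
rewrite ge0_integralTE//; apply: ereal_sup_ubound; exists h' => // x /=.
rewrite mindicE; have [xN|xN] := pselect (N x).
  by rewrite memNset ?mulr0//=; apply.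
rewrite mem_set//= mulr1; apply: le_trans (hg x) _.
by rewrite (_ : f x = g x)//; apply: contrapT => nfg; apply: xN; exact: Nfg.
Qed.

End NonmeasurableIntegrand.

Section FullGroup.
Context (d : measure_display) (X : measurableType d) (R : realType)
  (mu : probability X R).
Implicit Types (T U V W : mpbij mu) (u v w : Aut mu) (A B E S : set X).
Local Open Scope group_scope.

Local Hint Resolve mpfun_measurable mpinv_measurable measurable_idfun : core.

Lemma aut_repM u v : {ae mu, forall x, aut_rep (u * v) x = aut_rep u (aut_rep v x)}.
Proof. exact: ae_aut_rep. Qed.

Lemma aut_repV u : {ae mu, forall x, aut_rep u^-1 x = mpinv (aut_rep u) x}.
Proof. exact: ae_aut_rep. Qed.

Lemma aut_rep1 : {ae mu, forall x, aut_rep (1 : Aut mu) x = x}.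
Proof. exact: ae_aut_rep. Qed.

Lemma aut_repK u : {ae mu, forall x, aut_rep u^-1 (aut_rep u x) = x}.
Proof.
by have := ae_mpbij (aut_rep u) (aut_repV u); apply: filterS => x ->; rewrite mpfunK.
Qed.

Lemma aut_repKV u : {ae mu, forall x, aut_rep u (aut_rep u^-1 x) = x}.
Proof. by have := aut_repV u; apply: filterS => x ->; rewrite mpinvK. Qed.

Lemma aut_ext u v : {ae mu, forall x, aut_rep u x = aut_rep v x} -> u = v.
Proof. by move=> uv; rewrite -(aut_classK u) -(aut_classK v); exact/aut_class_eq. Qed.

Lemma aut_class_mul U V : aut_class U * aut_class V = aut_class (mpbijM U V).
Proof. exact: AutME. Qed.

Definition supported u S := {ae mu, forall x, ~ S x -> aut_rep u x = x}.

Lemma supportedS S' u S : S `<=` S' -> supported u S -> supported u S'.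
Proof.
move=> SS' uS; have uSx : {ae mu, forall x, ~ S x -> aut_rep u x = x} := uS.
by apply: filterS uSx => x uSx nS'; apply: uSx => /SS'.
Qed.

Lemma supportedM u v S : supported u S -> supported v S -> supported (u * v) S.
Proof.
move=> uS vS; apply: filterS3 (aut_repM u v) uS vS => x -> uS vS nSx.
by rewrite vS// uS.
Qed.

Lemma supported1 S : supported 1 S.
Proof. by have := aut_rep1; apply: filterS. Qed.

Lemma supportedV u S : supported u S -> supported u^-1 S.
Proof.
move=> uS; apply: filterS2 (aut_repK u) uS => x + uS nSx.
by rewrite uS.
Qed.

Lemma supported_set0 u S : mu S = 0%E -> measurable S -> supported u S -> u = 1.
Proof.
move=> S0 mS uS; apply: aut_ext.
have nS : {ae mu, forall x, ~ S x}.
  by exists S; split=> // x /= /contrapT.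
by apply: filterS3 aut_rep1 nS uS => x -> nS; exact.
Qed.

Lemma supportedJ u w S S' : {ae mu, forall x, S (aut_rep w x) -> S' x} ->
  supported u S -> supported (u ^ w) S'.
Proof.
move=> SS' uS; have uSw := ae_mpbij (aut_rep w) uS.
have M1 := aut_repM w^-1 (u * w); have M2 := aut_repM u w.
have K := aut_repK w.
have : {ae mu, forall x, ~ S' x -> aut_rep u (aut_rep w x) = aut_rep w x}.
  by apply: filterS2 SS' uSw => x SS' uSw nS'; apply: uSw; tauto.
move=> uw; rewrite conjgE; apply: filterS2 (filterI M1 M2) (filterI K uw).
by move=> x [-> ->] [wK uwx] nS'; rewrite uwx.
Qed.

Lemma supported_invariant u S : supported u S ->
  {ae mu, forall x, S x <-> S (aut_rep u x)}.
Proof.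
move=> uS; have uSu := ae_mpbij (aut_rep u) uS.
apply: filterS2 uSu uS => x uSu uS; split=> Sx; apply: contrapT => nS.
  by have /(can_inj (mpfunK _)) ux := uSu nS; apply: nS; rewrite ux.
by move: (nS); rewrite -(uS nS).
Qed.

Lemma supported_commute u v S S' : supported u S -> supported v S' ->
  S `&` S' = set0 -> commute u v.
Proof.
move=> uS vS' SS'; apply: aut_ext.
have dj x : S x -> ~ S' x.
  by move=> Sx S'x; have : set0 x by rewrite -SS'; split.
have uSv := ae_mpbij (aut_rep v) uS; have vSu := ae_mpbij (aut_rep u) vS'.
have iu := supported_invariant uS; have iv := supported_invariant vS'.
have : {ae mu, forall x, aut_rep u (aut_rep v x) = aut_rep v (aut_rep u x)}.
  have uSx : {ae mu, forall x, ~ S x -> aut_rep u x = x} := uS.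
  have vSx : {ae mu, forall x, ~ S' x -> aut_rep v x = x} := vS'.
  apply: filterS3 (filterI uSv vSu) (filterI iu iv) (filterI uSx vSx).
  move=> x [{}uSv {}vSu] [{}iu {}iv] [{}uSx {}vSx].
  have [Sx|nSx] := pselect (S x).
    by rewrite vSx ?vSu//; apply: dj => //; exact/iu.
  rewrite (uSx nSx); have [S'x|nS'x] := pselect (S' x).
    by rewrite uSv// => /dj; apply; exact/iv.
  by rewrite vSx// uSx.
by have := aut_repM u v; have := aut_repM v u; apply: filterS3 => x -> ->.
Qed.

Lemma measure_bigcup_gt0 (F : nat -> set X) : (forall j, measurable (F j)) ->
  (0 < mu (\bigcup_j F j))%E -> exists j, (0 < mu (F j))%E.
Proof.
move=> mF; apply: contraPP => no.
apply/negP; rewrite -leNgt measure_le0; apply/eqP.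
have mU : measurable (\bigcup_j F j) by exact: bigcupT_measurable.
apply/(negligibleP mu mU)/negligible_bigcup => j; apply/negligibleP => //.
apply/eqP; rewrite -measure_le0 leNgt; apply/negP => Fj.
by apply: no; exists j.
Qed.

Lemma displaced_subset (f : X -> X) A : standard_borel R X ->
  measurable_fun setT f -> measurable A -> (0 < mu (A `&` [set x | f x <> x]))%E ->
  exists B, [/\ measurable B, B `<=` A, (0 < mu B)%E & forall x, B x -> ~ B (f x)].
Proof.
move=> hX mf mA; have [C mC sepC] := standard_borel_separating hX.
pose F j := A `&` (C j `\` f @^-1` C j).
have mF j : measurable (F j).
  by apply: measurableI => //; apply: measurableD => //; exact: measurable_preimageT.
rewrite (_ : _ `&` _ = \bigcup_j F j) => [/(measure_bigcup_gt0 mF)[j Fj]|].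
  by exists (F j); split=> // [x []//|x [_ [_ nC]] [_ [/nC]]].
apply/seteqP; split=> [x [Ax /= fx]|x [j _ [Ax [Cx nCx]]]].
  by have [j Cx nCx] := sepC _ _ (nesym fx); exists j.
by split=> //= fx; apply: nCx; rewrite /= fx.
Qed.

Lemma nontrivial_displaces u : standard_borel R X -> u <> 1 ->
  exists A, [/\ measurable A, (0 < mu A)%E & forall x, A x -> ~ A (aut_rep u x)].
Proof.
move=> hX u1; have mE : measurable [set x | aut_rep u x <> x].
  by apply: (measurable_neq hX) => //; exact: measurable_idfun.
have mu_ := mpfun_measurable (aut_rep u).
have [|A [mA _ A0 Au]] := displaced_subset hX mu_ measurableT.
  rewrite setTI lt_neqAle measure_ge0 andbT eq_sym; apply/eqP => E0; apply: u1.
  by apply: supported_set0 E0 mE _; apply: aeW => x /contrapT.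
by exists A.
Qed.

Section Distance.
Context (hX : standard_borel R X) (T : mpbij mu).
Local Open Scope ereal_scope.

Definition dst u v : \bar R := Ldist T (aut_rep u) (aut_rep v).

Definition norm u : \bar R := Ldist T idfun (aut_rep u).

Lemma dst_sym u v : dst u v = dst v u.
Proof. exact: Ldist_sym. Qed.

Lemma dstxx u : dst u u = 0.
Proof. exact: Ldistxx. Qed.

Lemma dst_triangle v u w : dst u w <= dst u v + dst v w.
Proof. exact: Ldist_triangle. Qed.

Lemma dst_class U V : dst (aut_class U) (aut_class V) = Ldist T U V.
Proof. by apply: Ldist_ae => //; exact: ae_aut_rep. Qed.

Lemma normE u : norm u = dst 1%g u.
Proof.
rewrite /norm -[in RHS](aut_classK u).
by rewrite [RHS](dst_class (mpbij1 mu) (aut_rep u)).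
Qed.

(** Right multiplication is precomposition by a measure preserving map. *)
Lemma dstMr w u v : dst (u * w)%g (v * w)%g = dst u v.
Proof.
rewrite -(aut_classK u) -(aut_classK v) -(aut_classK w) !aut_class_mul !dst_class.
exact: Ldist_comp.
Qed.

Lemma norm1 : norm 1%g = 0.
Proof. by rewrite normE dstxx. Qed.

Lemma normV u : norm u^-1%g = norm u.
Proof. by rewrite !normE -(dstMr u) mul1g mulVg dst_sym. Qed.

Lemma norm_mul u v : norm (u * v)%g <= norm u + norm v.
Proof.
rewrite !normE addeC; apply: le_trans (dst_triangle v _ _) _; rewrite leeD2l//.
by rewrite -[X in dst X _]mul1g dstMr.
Qed.

Lemma normM_fin u v : norm u < +oo -> norm v < +oo -> norm (u * v)%g < +oo.
Proof. by move=> u1 v1; apply: le_lt_trans (norm_mul u v) _; exact: lte_add_pinfty. Qed.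

Lemma norm_dst_fin u v : norm u < +oo -> dst u v < +oo -> norm v < +oo.
Proof.
move=> u1 uv; rewrite normE; apply: le_lt_trans (dst_triangle u _ _) _.
by rewrite -normE; exact: lte_add_pinfty.
Qed.

Lemma norm_zorbit u : norm u < +oo -> {ae mu, forall x, zorbit T x (aut_rep u x)}.
Proof.
move=> u1; have mo : measurable_fun setT (fun x => odist T x (aut_rep u x)).
  by apply: (measurable_odist hX T) => //; exact: measurable_idfun.
have : mu.-integrable setT (fun x => odist T x (aut_rep u x)).
  apply/integrableP; split=> //.
  by under eq_integral do rewrite gee0_abs ?odist_ge0//.
move/integrable_ae => /(_ measurableT); apply: filterS => x /(_ I) fx.
by apply: odist_zorbit; rewrite ltey_eq fx.
Qed.

Definition converges (u_ : nat -> Aut mu) u := forall e : R, (0 < e)%R ->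
  exists K, forall k, (K <= k)%N -> dst u (u_ k) < e%:E.

Lemma converges_mull (u_ : nat -> Aut mu) u w : norm w < +oo -> converges u_ u ->
  converges (fun k => w * u_ k)%g (w * u)%g.
Proof.
move=> w1 cu e e0.
have e3 : (0 < e / 3)%R by rewrite divr_gt0.
have ml : measurable_fun setT (fun x => odist T x (aut_rep w x)).
  by apply: (measurable_odist hX T) => //; exact: measurable_idfun.
have [r r0 small] := integral_absolutely_continuous ml (fun=> odist_ge0 _ _ _) w1 e3.
have [K1 cK1] := cu _ e3; have [K2 cK2] := cu _ r0.
exists (maxn K1 K2) => k; rewrite geq_max => /andP[/cK1 ue /cK2 ur].
rewrite -{1 2}(aut_classK w) -(aut_classK u) -(aut_classK (u_ k)) !aut_class_mul.
rewrite dst_class; apply: le_lt_trans (Ldist_postcomp hX T _ _ _) _.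
set E := [set x | _]; have mE : measurable E by apply: (measurable_neq hX).
have muE : mu E < r%:E by apply: le_lt_trans ur; apply: (mu_neq_le hX).
rewrite (_ : e = e / 3 + e / 3 + e / 3)%R; last by field.
rewrite !EFinD; apply: lteD; first apply: lteD => //.
  by apply: small; rewrite ?mpinv_preserving//; exact: measurable_mpinvpre.
by apply: small; rewrite ?mpinv_preserving//; exact: measurable_mpinvpre.
Qed.

Lemma converges_mul (u_ v_ : nat -> Aut mu) u v : norm u < +oo -> converges u_ u ->
  converges v_ v -> converges (fun k => u_ k * v_ k)%g (u * v)%g.
Proof.
move=> u1 cu cv e e0; have e2 : (0 < e / 2)%R by rewrite divr_gt0.
have [K1 cK1] := converges_mull u1 cv e2; have [K2 cK2] := cu _ e2.
exists (maxn K1 K2) => k; rewrite geq_max => /andP[/cK1 uv /cK2 uu].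
apply: le_lt_trans (dst_triangle (u * v_ k)%g _ _) _.
by rewrite (splitr e) EFinD dstMr; exact: lteD.
Qed.

Lemma converges_inv (u_ : nat -> Aut mu) u : norm u < +oo -> converges u_ u ->
  converges (fun k => (u_ k)^-1)%g u^-1%g.
Proof.
move=> u1 cu; have u1V : norm u^-1%g < +oo by rewrite normV.
move=> e /(converges_mull u1V cu)[K cK]; exists K => k /cK.
by rewrite mulVg dst_sym -(mulVg (u_ k)) dstMr dst_sym.
Qed.

Lemma converges_comm (u_ v_ : nat -> Aut mu) u v : norm u < +oo -> norm v < +oo ->
  converges u_ u -> converges v_ v ->
  converges (fun k => [~ u_ k, v_ k])%g [~ u, v]%g.
Proof.
move=> u1 v1 cu cv; rewrite /commg /conjg.
apply: converges_mul; [by rewrite normV|exact: converges_inv|].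
apply: converges_mul; [by rewrite normV|exact: converges_inv|].
exact: converges_mul.
Qed.

End Distance.

End FullGroup.

(** * The cost of inducing *)

Section InducedDistance.
Context (d : measure_display) (X : measurableType d) (R : realType)
  (mu : probability X R) (hX : standard_borel R X).
Implicit Types (T U V W : mpbij mu) (A B E F : set X).
Local Open Scope ereal_scope.

Let measurable_step T U : measurable_fun setT (fun x => odist T x (U x)).
Proof.
apply: (measurable_odist hX T); first exact: measurable_idfun.
exact: mpfun_measurable.
Qed.

(** A point outside [E] skips the stretch of its [U]-orbit that lies in [E]. The
    sets [G i], of the points of [E] reached from outside [E] after exactly [i.+1]
    steps, are pairwise disjoint, and by invariance of the measure the [i]-th
    skipped steps have the same total length as the steps issued from [G i].
    So the skipped steps cost at most the integral over [E], and the points of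
    [E], which are frozen, cost that integral once more. *)
Lemma Ldist_induced T U W E : measurable E ->
  (forall x, E x -> W x = x) ->
  {ae mu, forall x, ~ E x -> exists n, W x = iter n.+1 U x /\
      forall i, (i < n)%N -> E (iter i.+1 U x)} ->
  Ldist T U W <= \int[mu]_(x in E) odist T x (U x) +
                 \int[mu]_(x in E) odist T x (U x).
Proof.
move=> mE WE Wret; pose l x := odist T x (U x).
have l0 x : 0 <= l x by exact: odist_ge0.
have ml : measurable_fun setT l by exact: measurable_step.
pose D i := [set x | ~ E x /\ forall j, (j <= i)%N -> E (iter j.+1 U x)].
pose V i := mpiter U i.+1.
have mD i : measurable (D i).
  rewrite (_ : D i = ~` E `&`
      \bigcap_(j in [set j | (j <= i)%N]) (iter j.+1 U @^-1` E)).
    apply: measurableI; first exact: measurableC.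
    by apply: bigcap_measurableType => j _; exact: measurable_iterpre.
  by apply/seteqP; split=> x [].
pose G i := mpinv (V i) @^-1` D i.
have mG i : measurable (G i) by exact: measurable_mpinvpre.
pose skip i := (fun x => l (V i x)) \_ (D i).
have skip0 i x : 0 <= skip i x by apply: erestrict_ge0.
have mskip i : measurable_fun setT (skip i).
  apply/(measurable_restrictT _ (mD i))/measurable_funTS.
  exact: measurableT_comp ml (mpfun_measurable _).
have mlE : measurable_fun setT (l \_ E).
  exact/(measurable_restrictT _ mE)/measurable_funTS.
have lE0 x : 0 <= (l \_ E) x by apply: erestrict_ge0.
have msum : measurable_fun setT (fun x => \sum_(i <oo) skip i x).
  exact: ge0_emeasurable_sum.
apply: (@le_trans _ _ (\int[mu]_x ((l \_ E) x + \sum_(i <oo) skip i x))).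
  apply: ae_ge0_le_integral => //.
  - by move=> x _; exact: odist_ge0.
  - by apply: (measurable_odist hX T); exact: mpfun_measurable.
  - by move=> x _; rewrite adde_ge0// nneseries_ge0.
  - exact: emeasurable_funD.
  apply: filterS Wret => x Wret _; have [Ex|nEx] := pselect (E x).
    by rewrite WE// patchE mem_set// odist_sym leeDl// nneseries_ge0.
  have [n [-> nE]] := Wret nEx.
  rewrite patchE memNset// add0e iterSr.
  apply: le_trans (odist_iter _ _ _ _) _.
  apply: le_trans (nneseries_lim_ge n _) => //; rewrite big_mkord.
  apply: lee_sum => i _; rewrite /skip patchE mem_set; first by rewrite mpiterE iterSr.
  by split=> // j ji; apply: nE; exact: leq_ltn_trans ji _.
rewrite ge0_integralD//; last by move=> x _; rewrite nneseries_ge0.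
rewrite -integral_mkcond leeD2l// integral_nneseries//.
have skipE i : \int[mu]_x skip i x = \int[mu]_(x in G i) l x.
  by rewrite /skip -integral_mkcond -(integral_mpbij (V i) (mG i))// mpinvpreK.
under eq_eseriesr do rewrite skipE.
have tG : trivIset setT G.
  apply/trivIsetP => i k _ _; wlog : i k / (i < k)%N => [wl|ik _].
    rewrite neq_ltn => /orP[ik|ki]; first by apply: wl => //; rewrite neq_ltn ik.
    by rewrite setIC; apply: wl => //; rewrite neq_ltn ki.
  apply/seteqP; split=> // y [[nEi _] [_ Ek]]; apply: nEi.
  have -> : mpinv (V i) y = iter (k - i) U (mpinv (V k) y).
    apply: (can_inj (mpfunK (V i))); rewrite mpinvK mpiterE -iterD.
    by rewrite -[LHS](mpinvK (V k)) mpiterE; congr (iter _ U _); lia.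
  by rewrite (_ : (k - i = (k - i).-1.+1)%N); [apply: Ek|]; lia.
rewrite -ge0_integral_bigcup//; last exact: measurable_funTS.
apply: ge0_subset_integral => //; first exact: bigcupT_measurable.
  exact: measurable_funTS.
move=> y [i _ [_ /(_ _ (leqnn i))]].
by rewrite -mpiterE mpinvK.
Qed.

End InducedDistance.

(** * Derived subgroups *)

Section SubgroupLemmas.
Local Open Scope group_scope.
Context (G : groupType).
Implicit Types (H A N : set G) (x y z a b : G).

Lemma smallest_is_subgroup A : is_subgroup (smallest (@is_subgroup _) A).
Proof.
split.
- by move=> M [[]].
- by move=> x y sx sy M MP; have [[_ mM _] _] := MP; apply: mM; [exact: sx|exact: sy].
- by move=> x sx M MP; have [[_ _ iM] _] := MP; apply: iM; exact: sx.
Qed.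

Lemma derived_is_subgroup H : is_subgroup (derived_subgroup H).
Proof. exact: smallest_is_subgroup. Qed.

Lemma derived_comm H x y : H x -> H y -> derived_subgroup H [~ x, y].
Proof. by move=> Hx Hy; apply: sub_gen_smallest; exists x => //; exists y. Qed.

Lemma derived_sub H N : is_subgroup N ->
  (forall x y, H x -> H y -> N [~ x, y]) -> derived_subgroup H `<=` N.
Proof.
by move=> sN HN; apply: smallest_sub => // _ [x Hx [y Hy <-]]; exact: HN.
Qed.

Lemma subgroup_comm H x y : is_subgroup H -> H x -> H y -> H [~ x, y].
Proof.
move=> [_ mH iH] Hx Hy; rewrite /commg /conjg.
by apply: (mH); [exact: iH|apply: (mH); [exact: iH|exact: mH]].
Qed.

Lemma subgroup_conj H x y : is_subgroup H -> H x -> H y -> H (x ^ y).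
Proof. by move=> [_ mH iH] Hx Hy; apply: (mH); [exact: iH|exact: mH]. Qed.

Lemma derived_subset H : is_subgroup H -> derived_subgroup H `<=` H.
Proof. by move=> sH; apply: derived_sub => // x y; exact: subgroup_comm. Qed.

Lemma commMg_commute x y z : commute y x -> commute y z -> [~ x * y, z] = [~ x, z].
Proof.
move=> yx yz.
have yzz : y ^ z = y by rewrite conjgE yz mulKg.
have cy : commute y [~ x, z].
  by rewrite /commg /conjg; do ?apply: commuteM => //; exact: commuteV.
by rewrite commgEl conjMg yzz invgM -mulgA (mulgA x^-1) -commgEl -cy mulKg.
Qed.

Lemma commgM_commute x y z : commute y z -> commute y x -> [~ x, z * y] = [~ x, z].
Proof. by move=> yz yx; rewrite -[LHS]invgK invgR commMg_commute// invgR. Qed.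

Lemma commMgM_commute x y z t : commute y x -> commute y z -> commute y t ->
  commute t x -> commute t z -> [~ x * y, z * t] = [~ x, z].
Proof.
move=> yx yz yt tx tz; rewrite commMg_commute ?commgM_commute//.
exact: commuteM.
Qed.

Let commMg x y z : [~ x * y, z] = [~ x, z] ^ y * [~ y, z].
Proof. by rewrite /commg /conjg !invgM !mulgA !mulgK. Qed.

Let commVg x z : [~ x^-1, z] = ([~ x, z] ^ x^-1)^-1.
Proof. by rewrite -conjVg invgR /commg /conjg !invgK !mulgA !mulgK. Qed.

(** The commutator of a product is a product of conjugates of commutators, and the
    conjugates of commutators of generators are again commutators of generators. *)
Lemma derived_sub_generators H P N : is_subgroup H -> is_subgroup N ->
  P `<=` H -> H `<=` smallest (@is_subgroup _) P ->
  (forall x y, P x -> H y -> P (x ^ y)) ->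
  (forall x y, P x -> P y -> N [~ x, y]) -> derived_subgroup H `<=` N.
Proof.
move=> sH [N1 mN iN] PH HP PJ PN; have [H1 mH iH] := sH.
have half (Q : set G) : Q `<=` H -> (forall x w, Q x -> H w -> Q (x ^ w)) ->
    (forall x y, P x -> Q y -> N [~ x, y]) ->
    forall x y, H x -> Q y -> N [~ x, y].
  move=> QH QJ PQ x y Hx Qy.
  have sZ : is_subgroup
      [set x | H x /\ forall w y, H w -> Q y -> N ([~ x, y] ^ w)].
    split.
    - by split=> // w z _ _; rewrite comm1g conj1g.
    - move=> a b [Ha aN] [Hb bN]; split=> [|w z Hw Qz]; first exact: mH.
      rewrite commMg conjMg -conjgM.
      by apply: (mN); [apply: aN => //; exact: mH|exact: bN].
    - move=> a [Ha aN]; split=> [|w z Hw Qz]; first exact: iH.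
      rewrite commVg conjVg -conjgM; apply: iN; apply: aN => //.
      by apply: mH => //; exact: iH.
  have PZ : P `<=` [set x | H x /\ forall w y, H w -> Q y -> N ([~ x, y] ^ w)].
    move=> a Pa; split; first exact: PH.
    by move=> w z Hw Qz; rewrite conjRg; apply: PQ; [exact: PJ|exact: QJ].
  have [_ /(_ 1 y H1 Qy)] := smallest_sub sZ PZ (HP _ Hx).
  by rewrite conjg1.
apply: derived_sub => // x y Hx Hy.
apply: (half H) => // [a b Ha Hb|a b Pa Hb]; first exact: subgroup_conj.
by rewrite -invgR; apply: iN; exact: (half P).
Qed.

End SubgroupLemmas.

(** * Elements of the integrable full group *)

Section FullGroupElements.
Context (d : measure_display) (X : measurableType d) (R : realType)
  (mu : probability X R) (hX : standard_borel R X) (T : mpbij mu).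
Implicit Types (U V W : mpbij mu) (u v w : Aut mu) (A B E S : set X).
Local Open Scope group_scope.

Local Hint Resolve mpfun_measurable mpinv_measurable measurable_idfun : core.

Definition integrable_group : set (Aut mu) := [set u | (norm T u < +oo)%E].

Lemma integrable_groupP : is_subgroup integrable_group.
Proof.
split; first by rewrite /integrable_group /= (norm1 hX).
- exact: (normM_fin hX).
- by move=> u; rewrite /integrable_group /= (normV hX).
Qed.

Lemma norm_class_bounded U k : (forall x, odist T x (U x) <= k%:R%:E)%E ->
  integrable_group (aut_class U).
Proof.
move=> Uk; rewrite /integrable_group /= (normE hX).
rewrite [X in (X < _)%E](dst_class hX T (mpbij1 mu) U).
apply: (@le_lt_trans _ _ (\int[mu]_x (k%:R%:E : \bar R))%E); last first.
  by rewrite integral_cst// [X in (_ * X)%E]probability_setT mule1 ltry.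
apply: ge0_le_integral => //.
- by move=> x _; exact: odist_ge0.
- by apply: (measurable_odist hX T).
Qed.

Lemma aut_class_inv U : (aut_class U)^-1 = aut_class (mpbijV U).
Proof.
apply: mulg1_eq; rewrite aut_class_mul; apply/aut_class_eq; apply: aeW => x.
exact: mpinvK.
Qed.

(** Inducing [u] on the complement of [E], within the full group. The quotient
    [u' * u^-1] is only supported near [E]; this is what splits [u] into elements
    of small support. *)
Lemma induced_element u E : integrable_group u -> measurable E ->
  exists u', [/\ integrable_group u',
    forall S, supported u S -> supported u' (S `\` E),
    (dst T u u' <= \int[mu]_(x in E) odist T x (aut_rep u x) +
                   \int[mu]_(x in E) odist T x (aut_rep u x))%E &
    exists S, [/\ measurable S, (mu S <= mu E + mu E)%E &
                supported (u' * u^-1) S]].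
Proof.
move=> Gu mE; have [W [WE Wit Wret]] := mpbij_induced (aut_rep u) (measurableC mE).
have {}WE x : E x -> W x = x by move=> Ex; apply: WE; exact.
have duW : dst T u (aut_class W) = Ldist T (aut_rep u) W.
  by rewrite -[in LHS](aut_classK u) (dst_class hX).
have Wdist : (dst T u (aut_class W) <=
    \int[mu]_(x in E) odist T x (aut_rep u x) +
    \int[mu]_(x in E) odist T x (aut_rep u x))%E.
  rewrite duW; apply: Ldist_induced => //.
  apply: filterS Wret => x Wret /Wret[n [-> _ nE]]; exists n; split=> // i /nE.
  exact: contrapT.
have Efin : (\int[mu]_(x in E) odist T x (aut_rep u x) < +oo)%E.
  apply: (le_lt_trans _ Gu); apply: ge0_subset_integral => //.
    by apply: (measurable_odist hX T).
  by move=> x _; exact: odist_ge0.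
exists (aut_class W); split=> //.
- by apply: (norm_dst_fin hX Gu); apply: le_lt_trans Wdist _; exact: lte_add_pinfty.
- move=> S uS; have uS' : {ae mu, forall x, ~ S x -> aut_rep u x = x} := uS.
  apply: filterS2 (ae_aut_rep W) uS' => x -> uSx nSE.
  have [Ex|nEx] := pselect (E x); first exact: WE.
  have [k ->] := Wit x; apply: iter_fix; apply: uSx => Sx.
  by apply: nSE; split.
- exists (E `|` mpinv (aut_rep u) @^-1` E); split.
  + by apply: measurableU => //; exact: measurable_mpinvpre.
  + apply: le_trans (measureU2 _ _ _) _ => //; first exact: measurable_mpinvpre.
    by rewrite [X in (_ + X <= _)%E](mpinv_preserving (aut_rep u) mE).
  + have -> : aut_class W * u^-1 = aut_class (mpbijM W (mpbijV (aut_rep u))).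
      by rewrite -[in LHS](aut_classK u) aut_class_inv aut_class_mul.
    have := ae_aut_rep (mpbijM W (mpbijV (aut_rep u))).
    have := ae_mpbij (mpbijV (aut_rep u)) Wret.
    apply: filterS2 => x /= Wr -> nS.
    have [|n [-> Fn nE]] := Wr; first by move=> Ex; apply: nS; right.
    case: n => [|n] in Fn nE *; first by rewrite /= mpinvK.
    by have := nE 0%N isT; rewrite /= mpinvK => nnE; case: nnE => Ex; apply: nS; left.
Qed.

(** Inducing successively on the complements of the members of a fine cover ends
    with the identity, and the successive quotients have small support. *)
Lemma small_support_generation (e : R) (Es : seq (set X)) u :
  (forall i, measurable (nth set0 Es i) /\ (mu (nth set0 Es i) <= e%:E)%E) ->
  integrable_group u -> supported u (\big[setU/set0]_(E <- Es) E) ->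
  smallest (@is_subgroup _) [set v | integrable_group v /\
    exists S, [/\ measurable S, (mu S <= (e + e)%:E)%E & supported v S]] u.
Proof.
set P := [set v | _]; have [P1 mP iP] := smallest_is_subgroup P.
have [_ mG iG] := integrable_groupP.
elim: Es u => [|E Es IH] u EsP Gu.
  by rewrite big_nil => /supported_set0 ->//; rewrite measure0.
rewrite big_cons => uS; have [mE Ee] := EsP 0%N.
have [u' [Gu' u'S _ [S [mS muS u'uS]]]] := induced_element Gu mE.
have -> : u = (u' * u^-1)^-1 * u' by rewrite invgM invgK mulgVK.
apply: (mP).
  apply: iP; apply: sub_gen_smallest; split; first by apply: mG => //; exact: iG.
  by exists S; split=> //; rewrite EFinD; apply: le_trans muS _; exact: leeD.
apply: IH => // [i|]; first exact: EsP i.+1.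
by apply: supportedS (u'S _ uS) => x [[]].
Qed.

Lemma swap_element n B : measurable B -> (forall x, B x -> ~ B (zpow T n x)) ->
  exists s : mpbij mu, [/\ integrable_group (aut_class s),
    forall x, B x -> s x = zpow T n x,
    forall x, B (s x) -> x = zpow T n (s x),
    forall x, ~ B x -> ~ B (zpow T (- n) x) -> s x = x & mpinv s =1 s].
Proof.
move=> mB BU.
have [|s [s0 s1 s2 sV]] := @mpbij_swap _ _ _ _ (mpz T n) B mB.
  by move=> x; rewrite mpzE; exact: BU.
have {}s0 x : B x -> s x = zpow T n x by move=> /s0; rewrite mpzE.
have {}s1 x : B (zpow T (- n) x) -> s x = zpow T (- n) x.
  by rewrite -mpzVE; exact: s1.
have {}s2 x : ~ B x -> ~ B (zpow T (- n) x) -> s x = x.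
  by rewrite -mpzVE; exact: s2.
exists s; split=> //.
  apply: (@norm_class_bounded _ `|n|%N) => x.
  have [/s0 ->|nB] := pselect (B x); first exact: odist_le.
  have [/s1 ->|nB'] := pselect (B (zpow T (- n) x)).
    by apply: le_trans (odist_le _ _ _) _; rewrite abszN.
  by rewrite s2// odistxx lee_fin.
by move=> x Bs; rewrite -s0// -{1}sV mpfunK.
Qed.

(** The commutator of the two involutions exchanging [B] with [T^n B] and
    with [T^m B] permutes the three sets cyclically. *)
Lemma three_cycle n m B : measurable B ->
  (forall x, B x -> ~ B (zpow T n x)) -> (forall x, B x -> ~ B (zpow T m x)) ->
  (forall x y, B x -> B y -> zpow T n x <> zpow T m y) ->
  exists2 c, derived_subgroup integrable_group c &
    {ae mu, forall x, (B x -> aut_rep c x = zpow T n x) /\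
      (~ B x -> ~ B (zpow T (- n) x) -> ~ B (zpow T (- m) x) -> aut_rep c x = x)}.
Proof.
move=> mB Bn Bm Bnm.
have [s [Gs s0 _ s2 sV]] := swap_element mB Bn.
have [t [Gt t0 _ t2 tV]] := swap_element mB Bm.
exists [~ aut_class s, aut_class t]; first exact: derived_comm.
pose c := mpbijM (mpbijV s) (mpbijM (mpbijV t) (mpbijM s t)).
have -> : [~ aut_class s, aut_class t] = aut_class c.
  rewrite /commg /conjg !aut_class_inv (aut_class_mul s t).
  by rewrite (aut_class_mul _ (mpbijM s t)) (aut_class_mul (mpbijV s)).
apply: filterS (ae_aut_rep c) => x -> /=; split=> [Bx|nB nBn nBm].
  rewrite (t0 _ Bx) (s2 (zpow T m x)); last 2 first.
  - exact: Bm.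
  - by move=> By; apply: (Bnm _ _ By Bx); rewrite zpowKN.
  by rewrite -(t0 _ Bx) mpfunK sV s0.
have tx : t x = x by exact: t2.
have sx : s x = x by exact: s2.
by rewrite tx sx -[X in mpinv t X]tx mpfunK -[X in mpinv s X]sx mpfunK.
Qed.

End FullGroupElements.

(** * Consequences of ergodicity and of the absence of atoms *)

Section ErgodicSets.
Context (d : measure_display) (X : measurableType d) (R : realType)
  (mu : probability X R) (hX : standard_borel R X) (T : mpbij mu).
Implicit Types (u v w : Aut mu) (A B E S P Q : set X) (n m : int) (k : nat).
Local Open Scope ereal_scope.

Lemma measurable_zpowpre n A : measurable A -> measurable (zpow T n @^-1` A).
Proof. by move=> mA; exact: measurable_preimageT (zpow_measurable T n) mA. Qed.

Lemma zpow_preserving n A : measurable A -> mu (zpow T n @^-1` A) = mu A.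
Proof.
move=> mA; rewrite -[RHS](mpfun_preserving (mpz T n))//; congr (mu _).
by apply/seteqP; split=> x /=; rewrite mpzE.
Qed.

Let muDI A B : measurable A -> measurable B ->
  mu A = mu (A `\` B) + mu (A `&` B).
Proof. exact: measureDI. Qed.

Lemma measure_gt0_nonempty A : 0 < mu A -> A !=set0.
Proof.
by move=> A0; apply/set0P/eqP => AE; move: A0; rewrite AE measure0 ltxx.
Qed.

Lemma measure_decreasing_cvg (F : nat -> set X) :
  (forall k, measurable (F k)) -> (forall k, F k.+1 `<=` F k) ->
  mu \o F @ \oo --> mu (\bigcap_k F k).
Proof.
move=> mF dF; apply: nonincreasing_cvg_mu => //.
- by rewrite -ge0_fin_numE// fin_num_measure.
- exact: bigcapT_measurable.
- by apply/nonincreasing_seqP => k; apply/subsetPset.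
Qed.

Lemma measure_decreasing_small (F : nat -> set X) :
  (forall k, measurable (F k)) -> (forall k, F k.+1 `<=` F k) ->
  mu (\bigcap_k F k) = 0 -> forall e : R, (0 < e)%R ->
  exists K, forall k, (K <= k)%N -> mu (F k) < e%:E.
Proof.
move=> mF dF F0 e e0; have := measure_decreasing_cvg mF dF.
rewrite F0 => /fine_cvgP[_ /cvgrPdist_lt /(_ _ e0)[K _ HK]].
exists K => k /HK /=; rewrite sub0r normrN ger0_norm ?fine_ge0// => ltk.
by rewrite -[mu _]fineK ?fin_num_measure// lte_fin.
Qed.

Lemma ergodic_meet P Q : ergodic T -> measurable P -> measurable Q ->
  0 < mu P -> 0 < mu Q -> exists n, 0 < mu (P `&` zpow T n @^-1` Q).
Proof.
move=> erg mP mQ P0 Q0.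
pose F j := if unpickle j is Some n then zpow T n @^-1` Q else set0.
have mF j : measurable (F j).
  by rewrite /F; case: unpickle => [n|//]; exact: measurable_zpowpre.
pose O := \bigcup_j F j; have mO : measurable O by exact: bigcupT_measurable.
have OE x : O x <-> exists n, Q (zpow T n x).
  split=> [[j _]|[n Qn]]; first by rewrite /F; case: unpickle => // n; exists n.
  by exists (pickle n) => //; rewrite /F pickleK.
have O1 : mu O = 1.
  have Oinv : O = \bigcup_(x in O) zorbit T x.
    apply/seteqP; split=> [x Ox|y [x /OE[n Qn] [m _ <-]]].
      by exists x => //; exact: zorbit_refl.
    by apply/OE; exists (n - m)%R; rewrite -zpowD subrK.
  have QO : mu Q <= mu O.
    apply: le_measure; rewrite ?inE// => x Qx.
    by apply/OE; exists 0%R.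
  by case: (erg O mO Oinv) => // O0; move: QO; rewrite O0 leNgt Q0.
have PO : 0 < mu (P `&` O).
  have PCO : mu (P `\` O) = 0.
    apply/eqP; rewrite -measure_le0; apply: (@le_trans _ _ (mu (~` O))).
      apply: le_measure; rewrite ?inE; [exact: measurableD|exact: measurableC|].
      by move=> x [].
    by rewrite probability_setC// O1 subee.
  by move: P0; rewrite (muDI mP mO) PCO add0e.
have PF : P `&` O = \bigcup_j (P `&` F j) by rewrite setI_bigcupr.
rewrite PF in PO; have [|j] := measure_bigcup_gt0 _ PO.
  by move=> j; exact: measurableI.
rewrite /F; case: unpickle => [n|]; last by rewrite setI0 measure0 ltxx.
by exists n.
Qed.

Lemma non_atomic_split A : non_atomic mu -> measurable A -> 0 < mu A ->
  exists B, [/\ measurable B, B `<=` A, 0 < mu B & 0 < mu (A `\` B)].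
Proof.
move=> na mA A0; apply: contrapT => no; apply: na; exists A; split=> // B mB BA.
have [B0|B0] := eqVneq (mu B) 0; [by left|right].
have [AB0|AB0] := eqVneq (mu (A `\` B)) 0; last first.
  by case: no; exists B; rewrite !lt_neqAle !measure_ge0 !andbT !(eq_sym 0).
by rewrite (muDI mA mB) AB0 add0e (setIidr BA).
Qed.

Lemma non_atomic_small : non_atomic mu -> forall e : R, (0 < e)%R ->
  exists B, [/\ measurable B, 0 < mu B & mu B <= e%:E].
Proof.
move=> na; have halving k : exists B, [/\ measurable B, 0 < mu B &
    mu B <= (2 ^- k)%:E].
  elim: k => [|k [B [mB B0 Bk]]].
    exists setT; rewrite invr1 probability_setT; split=> //.
  have [C [mC CB C0 BC0]] := non_atomic_split na mB B0.
  have mBC : measurable (B `\` C) by exact: measurableD.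
  have BE : mu B = mu (B `\` C) + mu C.
    by rewrite (muDI mB mC) (setIidr CB).
  have half D D' : mu D <= mu D' -> mu D + mu D' <= (2 ^- k)%:E ->
      mu D <= (2 ^- k.+1)%:E.
    move=> DD' DDk; rewrite exprS invfM mulrC EFinM lee_pdivlMr// muleC.
    by rewrite mule_natl mule2n (le_trans _ DDk)// leeD2l.
  have [le|le] := leP (mu C) (mu (B `\` C)).
    by exists C; split=> //; apply: (half _ _ le); rewrite addeC -BE.
  by exists (B `\` C); split=> //; apply: (half _ _ (ltW le)); rewrite -BE.
move=> e e0; have [k ke] : exists k : nat, (2 ^- k <= e)%R.
  have [k] := ltr_add_invr e0; rewrite add0r => /ltW ke; exists k.
  apply: le_trans ke; rewrite lef_pV2 ?posrE ?exprn_gt0//.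
  by rewrite -natrX ler_nat; exact: ltn_expl.
have [B [mB B0 Bk]] := halving k; exists B; split=> //.
by apply: le_trans Bk _; rewrite lee_fin.
Qed.

(** By ergodicity finitely many translates of a small set leave only a small
    remainder, which is the first member of the cover. *)
Lemma small_cover : ergodic T -> non_atomic mu -> forall e : R, (0 < e)%R ->
  exists2 Es : seq (set X),
    forall i, measurable (nth set0 Es i) /\ mu (nth set0 Es i) <= e%:E &
    \big[setU/set0]_(E <- Es) E = setT.
Proof.
move=> erg na e e0; have [B [mB B0 Be]] := non_atomic_small na e0.
pose F j := if unpickle j is Some n then zpow T n @^-1` B else set0.
have mF j : measurable (F j).
  by rewrite /F; case: unpickle => [n|//]; exact: measurable_zpowpre.
have Fe j : mu (F j) <= e%:E.
  rewrite /F; case: unpickle => [n|]; first by rewrite zpow_preserving.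
  by rewrite measure0 lee_fin ltW.
pose O k := \big[setU/set0]_(j < k) F j.
have mO k : measurable (O k) by exact: bigsetU_measurable.
have mC k : measurable (~` O k) by exact: measurableC.
have C0 : mu (\bigcap_k ~` O k) = 0.
  have mI : measurable (\bigcap_k ~` O k) by exact: bigcapT_measurable.
  apply/eqP; rewrite -measure_le0 leNgt; apply/negP => I0.
  have [n /measure_gt0_nonempty[x [Ix Bx]]] := ergodic_meet erg mI mB I0 B0.
  apply: (Ix (pickle n).+1 I); rewrite /O big_ord_recr /=; right.
  by rewrite /F pickleK.
have [|K CK] := measure_decreasing_small mC _ C0 e0.
  by move=> k x nO Ox; apply: nO; rewrite /O big_ord_recr; left.
exists ((~` O K) :: [seq F j | j <- iota 0 K]).
  case=> [|i]; first by split=> //=; apply/ltW/CK.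
  rewrite /=; have [ik|ik] := ltnP i K; last first.
    by rewrite nth_default ?size_map ?size_iota// measure0 lee_fin ltW.
  by rewrite (nth_map 0%N) ?size_iota// nth_iota.
rewrite big_cons big_map -[K in iota _ K]subn0 -/(index_iota 0 K) big_mkord.
exact: setvU.
Qed.

End ErgodicSets.

(** * Moving small sets by elements of the derived group *)

Section Transport.
Context (d : measure_display) (X : measurableType d) (R : realType)
  (mu : probability X R) (hX : standard_borel R X) (T : mpbij mu).
Implicit Types (t : set X * set X * set X) (nm : int * int) (A B S P Q : set X).
Local Open Scope ereal_scope.

Definition cycle_piece nm t : set X :=
  t.1.1 `&` zpow T nm.1 @^-1` t.1.2 `&` zpow T nm.2 @^-1` t.2.

Definition cycle_step nm t : set X * set X * set X :=
  let p := cycle_piece nm t in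
  (t.1.1 `\` p, t.1.2 `\` zpow T (- nm.1) @^-1` p, t.2 `\` zpow T (- nm.2) @^-1` p).

(** Greedy exhaustion over an enumeration of the pairs of powers of [T]. The three
    sets lose the same measure at each step, and no pair of powers is any use
    between the final remainders. At the indices that code no pair, the default
    [(0, 0)] makes the piece empty if the sets are disjoint. *)
Fixpoint leftover t k : set X * set X * set X :=
  if k is k'.+1 then cycle_step (odflt (0, 0)%R (unpickle k')) (leftover t k')
  else t.

Definition measurable3 t : Prop :=
  [/\ measurable t.1.1, measurable t.1.2 & measurable t.2].

Definition disjoint3 t : Prop := [/\ t.1.1 `&` t.1.2 = set0,
  t.1.1 `&` t.2 = set0 & t.1.2 `&` t.2 = set0].

Let measurable_piece nm t : measurable3 t -> measurable (cycle_piece nm t).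
Proof.
move=> [m1 m2 m3]; apply: measurableI; [apply: measurableI => //|];
  exact: measurable_zpowpre.
Qed.

Let measurable_step nm t : measurable3 t -> measurable3 (cycle_step nm t).
Proof.
move=> mt; have mp := measurable_piece nm mt; have [m1 m2 m3] := mt.
by split; apply: measurableD => //; exact: measurable_zpowpre.
Qed.

Let disjoint_step nm t : disjoint3 t -> disjoint3 (cycle_step nm t).
Proof.
move=> [d1 d2 d3].
by split; apply/seteqP; split=> // x [[xa _] [xb _]];
  [rewrite -d1|rewrite -d2|rewrite -d3].
Qed.

Let piece_image nm t x : cycle_piece nm t x ->
  [/\ t.1.1 x, t.1.2 (zpow T nm.1 x) & t.2 (zpow T nm.2 x)].
Proof. by move=> [[]]. Qed.

Let mu_diff_le A B P Q : measurable A -> measurable B -> measurable P ->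
  measurable Q -> P `<=` A -> Q `<=` B -> mu P = mu Q -> mu A <= mu B ->
  mu (A `\` P) <= mu (B `\` Q).
Proof.
move=> mA mB mP mQ PA QB PQ AB.
have DE C D : measurable C -> measurable D -> D `<=` C ->
    mu (C `\` D) = mu C - mu D.
  move=> mC mD DC; rewrite measureD// ?(setIidr DC)//.
  by rewrite -ge0_fin_numE// fin_num_measure.
by rewrite !DE// PQ leeB.
Qed.

Let measure_step nm t : measurable3 t ->
  mu t.1.1 <= mu t.1.2 -> mu t.1.1 <= mu t.2 ->
  mu (cycle_step nm t).1.1 <= mu (cycle_step nm t).1.2 /\
  mu (cycle_step nm t).1.1 <= mu (cycle_step nm t).2.
Proof.
move=> mt le1 le2; have mp := measurable_piece nm mt; have [m1 m2 m3] := mt.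
split; apply: mu_diff_le => //; try exact: measurable_zpowpre.
- by move=> x /piece_image[].
- by move=> x /= /piece_image[_ + _]; rewrite zpowKN.
- by rewrite zpow_preserving.
- by move=> x /piece_image[].
- by move=> x /= /piece_image[_ _]; rewrite zpowKN.
- by rewrite zpow_preserving.
Qed.

Let cycle_of_step nm t : measurable3 t -> disjoint3 t ->
  exists2 c, derived_subgroup (integrable_group T) c &
    {ae mu, forall x, (cycle_piece nm t x -> aut_rep c x = zpow T nm.1 x) /\
      (~ cycle_piece nm t x -> ~ cycle_piece nm t (zpow T (- nm.1) x) ->
       ~ cycle_piece nm t (zpow T (- nm.2) x) -> aut_rep c x = x)}.
Proof.
move=> mt [d1 d2 d3]; apply: (three_cycle hX (measurable_piece nm mt)).
- move=> x /piece_image[_ x2 _] /piece_image[x1 _ _].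
  by have : set0 (zpow T nm.1 x) by rewrite -d1.
- move=> x /piece_image[_ _ x2] /piece_image[x1 _ _].
  by have : set0 (zpow T nm.2 x) by rewrite -d2.
- move=> x y /piece_image[_ x2 _] /piece_image[_ _ x3] xy.
  by have : set0 (zpow T nm.1 x) by rewrite -d3; split=> //; rewrite xy.
Qed.

Let leftover_props t k : measurable3 t -> disjoint3 t ->
  mu t.1.1 <= mu t.1.2 -> mu t.1.1 <= mu t.2 ->
  [/\ measurable3 (leftover t k), disjoint3 (leftover t k),
      mu (leftover t k).1.1 <= mu (leftover t k).1.2,
      mu (leftover t k).1.1 <= mu (leftover t k).2 &
      [/\ (leftover t k).1.1 `<=` t.1.1, (leftover t k).1.2 `<=` t.1.2 &
          (leftover t k).2 `<=` t.2]].
Proof.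
move=> mt dt le1 le2.
elim: k => [|k [mk dk le1k le2k [s1 s2 s3]]]; first by split=> //; split=> x.
rewrite [leftover t k.+1]/=; set nm := odflt _ _.
have [l1 l2] := measure_step nm mk le1k le2k; split=> //.
- exact: measurable_step.
- exact: disjoint_step.
- by split; apply: subset_trans (@subDsetl _ _ _) _.
Qed.

Let leftover_transport t k : measurable3 t -> disjoint3 t ->
  mu t.1.1 <= mu t.1.2 -> mu t.1.1 <= mu t.2 ->
  exists2 h, derived_subgroup (integrable_group T) h &
    {ae mu, forall x,
      ((leftover t k).1.1 x \/ (leftover t k).1.2 x \/ (leftover t k).2 x ->
        aut_rep h x = x) /\
      (t.1.1 x -> ~ (leftover t k).1.1 x -> t.1.2 (aut_rep h x))}.
Proof.
move=> mt dt le1 le2; elim: k => [|k [h Dh hP]].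
  have [D1 _ _] := derived_is_subgroup (integrable_group T).
  by exists 1%g => //; apply: filterS (aut_rep1 mu) => x ->.
have [mk dk _ _ [s1 s2 s3]] := leftover_props k mt dt le1 le2.
rewrite [leftover t k.+1]/=; set nm := odflt _ _.
have [c Dc cP] := cycle_of_step nm mk dk.
have [_ Dmul _] := derived_is_subgroup (integrable_group T).
exists (h * c)%g; first exact: Dmul.
have [dk1 dk2 dk3] := dk; have [dt1 dt2 dt3] := dt.
have no (Y Z : set X) x : Y `&` Z = set0 -> Y x -> Z x -> False.
  by move=> YZ Yx Zx; have : set0 x by rewrite -YZ.
apply: filterS3 (filterI (aut_repM h c) cP) hP (ae_mpbij (aut_rep c) hP).
move=> x [-> [cp cfix]] [hfix hS] [hcfix hcS].
set l := leftover t k in s1 s2 s3 cp cfix hfix hS hcfix dk1 dk2 dk3 *.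
have q1 : cycle_piece nm l (zpow T (- nm.1) x) -> l.1.2 x.
  by move=> /piece_image[_ + _]; rewrite zpowKN.
have q2 : cycle_piece nm l (zpow T (- nm.2) x) -> l.2 x.
  by move=> /piece_image[_ _]; rewrite zpowKN.
have q0 : cycle_piece nm l x -> l.1.1 x by move=> /piece_image[].
split.
- rewrite /cycle_step /= => xl.
  have cx : aut_rep c x = x.
    case: xl => [[x1 np]|[[x2 np]|[x3 np]]]; apply: cfix => //.
    + by move=> /q1; exact: (no _ _ x dk1).
    + by move=> /q2; exact: (no _ _ x dk2).
    + by move=> /q0 x1; exact: (no _ _ x dk1).
    + by move=> /q2; exact: (no _ _ x dk3).
    + by move=> /q0 x1; exact: (no _ _ x dk2).
    + by move=> /q1 x2; exact: (no _ _ x dk3).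
  rewrite cx; apply: hfix.
  by case: xl => [[]|[[]|[]]]; [left|right; left|right; right].
- move=> Sx; rewrite /cycle_step /= => nl.
  have [px|npx] := pselect (cycle_piece nm l x).
    have [_ x2 _] := piece_image px.
    have cx := cp px; rewrite hcfix cx; first exact: s2.
    by right; left.
  have nlx : ~ l.1.1 x by move=> lx; apply: nl.
  rewrite cfix//; first exact: hS.
    by move=> /q1 /s2; exact: (no _ _ x dt1).
  by move=> /q2 /s3; exact: (no _ _ x dt2).
Qed.

(** If the exhaustion left some of [S] over, it would leave at least as much of
    [Q] and of [P], and ergodicity would provide one more piece to move. The third
    set [P] is there to make three-cycles, which are commutators, instead of
    transpositions. Only finitely many powers of [T] are used at each stage, so
    that integrability is free; an element carrying the whole of [S] into [Q]
    might fail to be integrable, hence the error sets [E k]. *)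
Lemma transport : ergodic T -> forall S Q P, measurable S -> measurable Q ->
  measurable P -> S `&` Q = set0 -> S `&` P = set0 -> Q `&` P = set0 ->
  mu S <= mu Q -> mu S <= mu P ->
  exists (h : nat -> Aut mu) (E : nat -> set X),
    [/\ forall k, derived_subgroup (integrable_group T) (h k),
        forall k, measurable (E k),
        forall e : R, (0 < e)%R -> exists K, forall k, (K <= k)%N -> mu (E k) < e%:E &
        forall k, {ae mu, forall x, S x -> ~ E k x -> Q (aut_rep (h k) x)}].
Proof.
move=> erg S Q P mS mQ mP SQ SP QP SQle SPle.
pose t := (S, Q, P).
have mt : measurable3 t by []. have dt : disjoint3 t by [].
pose l k := leftover t k.
have lP k := leftover_props k mt dt SQle SPle.
have hP k := leftover_transport k mt dt SQle SPle.
exists (fun k => sval (cid2 (hP k))), (fun k => (l k).1.1).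
split=> [k|k||k].
- by case: cid2.
- by have [[]] := lP k.
- pose E1 := \bigcap_k (l k).1.1; pose E2 := \bigcap_k (l k).1.2.
  pose E3 := \bigcap_k (l k).2.
  have m1 k : measurable (l k).1.1 by have [[]] := lP k.
  have m2 k : measurable (l k).1.2 by have [[]] := lP k.
  have m3 k : measurable (l k).2 by have [[]] := lP k.
  have d1 k : (l k.+1).1.1 `<=` (l k).1.1 by exact: subDsetl.
  have d2 k : (l k.+1).1.2 `<=` (l k).1.2 by exact: subDsetl.
  have d3 k : (l k.+1).2 `<=` (l k).2 by exact: subDsetl.
  have le F F' : (forall k, measurable (F k)) -> (forall k, F k.+1 `<=` F k) ->
      (forall k, measurable (F' k)) -> (forall k, F' k.+1 `<=` F' k) ->
      (forall k, mu (F k) <= mu (F' k)) -> mu (\bigcap_k F k) <= mu (\bigcap_k F' k).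
    move=> mF dF mF' dF' FF'.
    have c1 := measure_decreasing_cvg (mu := mu) mF dF.
    have c2 := measure_decreasing_cvg (mu := mu) mF' dF'.
    rewrite -(cvg_lim (@ereal_hausdorff R) c1) -(cvg_lim (@ereal_hausdorff R) c2).
    apply: lee_lim; [by apply/cvg_ex; eexists; exact: c1|
      by apply/cvg_ex; eexists; exact: c2|].
    by apply: nearW => k; exact: FF'.
  have E12 : mu E1 <= mu E2 by apply: le => // k; have [] := lP k.
  have E13 : mu E1 <= mu E3 by apply: le => // k; have [] := lP k.
  have mE1 : measurable E1 by exact: bigcapT_measurable.
  have mE2 : measurable E2 by exact: bigcapT_measurable.
  have mE3 : measurable E3 by exact: bigcapT_measurable.
  apply: measure_decreasing_small => //.
  apply/eqP; rewrite -measure_le0 leNgt; apply/negP => E10.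
  have [n En] := ergodic_meet erg mE1 mE2 E10 (lt_le_trans E10 E12).
  have mEn : measurable (E1 `&` zpow T n @^-1` E2).
    by apply: measurableI => //; exact: measurable_zpowpre.
  have [m Em] := ergodic_meet erg mEn mE3 En (lt_le_trans E10 E13).
  have [x [[x1 x2] x3]] := measure_gt0_nonempty Em.
  have [_] := x1 (pickle (n, m)).+1 I; apply.
  by rewrite pickleK; do !split; [exact: x1|exact: x2|exact: x3].
- by case: cid2 => h _ /=; apply: filterS => x [].
Qed.

End Transport.

(** * Closed normal subgroups contain the derived group *)

Section NormalSubgroups.
Context (d : measure_display) (X : measurableType d) (R : realType)
  (mu : probability X R) (hX : standard_borel R X) (hmu : non_atomic mu)
  (T : mpbij mu) (erg : ergodic T).
Implicit Types (u v w g : Aut mu) (A B E S P Q : set X).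
Local Open Scope group_scope.

Local Notation G := (integrable_group T).
Local Notation D := (derived_subgroup G).

Let sG : is_subgroup G := integrable_groupP hX T.
Let sD : is_subgroup D := derived_is_subgroup G.
Let DG : D `<=` G := derived_subset sG.

Context (N : set (Aut mu)) (sN : is_subgroup N)
  (NJ : forall x y, N x -> D y -> N (x ^ y)).

(** The commutator trick: if [g] moves [A] off itself, then [u] differs from
    [[~ u^-1, g]], which lies in [N], by a factor supported outside [A]; that factor
    does not affect the commutator with [v]. *)
Let comm_displaced g A u v : N g -> (forall x, A x -> ~ A (aut_rep g x)) ->
  D u -> D v -> supported u A -> supported v A -> N [~ u, v].
Proof.
move=> Ng gA Du Dv uA vA; have [_ mN iN] := sN; have [_ _ iD] := sD.
have uVA := supportedV uA.
have ugA : supported (u^-1 ^ g) (aut_rep g @^-1` A).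
  by apply: supportedJ uVA; exact: aeW.
have disj : (aut_rep g @^-1` A) `&` A = set0.
  by apply/seteqP; split=> // x [/= Agx /gA].
have Nn : N [~ u^-1, g].
  by rewrite commgEr; apply: (mN) => //; apply: NJ; [exact: iN|exact: iD].
rewrite -(@commMg_commute _ u (u^-1 ^ g) v); last 2 first.
- exact: supported_commute ugA uA disj.
- exact: supported_commute ugA vA disj.
rewrite -{1}[u]invgK -commgEl [X in N X]commgEl; apply: (mN); first exact: iN.
exact: NJ.
Qed.

Let swap_conj n P Q : measurable P -> P `<=` zpow T n @^-1` Q ->
  (forall x, P x -> ~ Q x) -> exists2 f, G f &
    forall u, supported u P -> supported (u ^ f) Q.
Proof.
move=> mP PQ dPQ.
have nP x : P x -> ~ P (zpow T n x) by move=> /PQ /= Qx /dPQ.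
have [s [Gs s0 s1 _ _]] := swap_element hX mP nP.
exists (aut_class s) => // u uP; apply: supportedJ uP.
apply: filterS (ae_aut_rep s) => x -> Psx.
by rewrite (s1 _ Psx); exact: PQ.
Qed.

(** An element [u] of [G] supported in [B] need not lie in [D], but
    [u * u^-1 ^ f] does, being a commutator, and it is still supported in [A]
    if [f] carries [B] into a part [Q] of [A]. For [v] another part [P] is used;
    [B], [Q] and [P] being disjoint, the added factors commute with all the others
    and leave the commutator of [u] and [v] unchanged. *)
Let local_commutators g : N g -> g <> 1 -> exists B,
  [/\ measurable B, (0 < mu B)%E & forall u v, G u -> G v ->
    supported u B -> supported v B -> N [~ u, v]].
Proof.
move=> Ng g1; have [A [mA A0 gA]] := nontrivial_displaces hX g1.
have [S [mS SA S0 AS0]] := non_atomic_split hmu mA A0.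
have mAS : measurable (A `\` S) by exact: measurableD.
have [Q [mQ QAS Q0 P0]] := non_atomic_split hmu mAS AS0.
set P := (A `\` S) `\` Q in P0; have mP : measurable P by exact: measurableD.
have [n Sn] := ergodic_meet erg mS mQ S0 Q0.
have mSn : measurable (S `&` zpow T n @^-1` Q).
  by apply: measurableI => //; exact: measurable_zpowpre.
have [m B0] := ergodic_meet erg mSn mP Sn P0.
set B := (S `&` zpow T n @^-1` Q) `&` zpow T m @^-1` P in B0.
have mB : measurable B by apply: measurableI => //; exact: measurable_zpowpre.
have BS : B `<=` S by move=> x [[]].
have SQ x : S x -> ~ Q x by move=> Sx /QAS[].
have SP x : S x -> ~ P x by move=> Sx [[]].
have BQ x : B x -> ~ Q x by move=> /BS /SQ.
have BP x : B x -> ~ P x by move=> /BS /SP.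
have BnQ : B `<=` zpow T n @^-1` Q by move=> x [[]].
have BmP : B `<=` zpow T m @^-1` P by move=> x [].
have [f Gf fQ] := swap_conj mB BnQ BQ; have [f' Gf' fP] := swap_conj mB BmP BP.
have [_ mG iG] := sG.
have BA : B `<=` A by move=> x /BS /SA.
have QA : Q `<=` A by move=> x /QAS[].
have PA : P `<=` A by move=> x [[]].
exists B; split=> // u v Gu Gv uB vB.
have dBQ : Q `&` B = set0 by apply/seteqP; split=> // x [Qx /BS/SQ].
have dBP : P `&` B = set0 by apply/seteqP; split=> // x [Px /BS/SP].
have dQP : Q `&` P = set0 by apply/seteqP; split=> // x [Qx []].
have copy z f0 Y : G z -> G f0 -> supported z B -> Y `<=` A ->
    supported (z^-1 ^ f0) Y -> D (z * z^-1 ^ f0) /\ supported (z * z^-1 ^ f0) A.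
  move=> Gz Gf0 zB YA zY; split.
    by rewrite -{1}[z]invgK -commgEl; apply: derived_comm => //; exact: iG.
  by apply: supportedM; [exact: (supportedS BA)|exact: supportedS zY].
have uQ := fQ _ (supportedV uB); have vP := fP _ (supportedV vB).
have [Du uA] := copy u f Q Gu Gf uB QA uQ.
have [Dv vA] := copy v f' P Gv Gf' vB PA vP.
rewrite -(@commMgM_commute _ u (u^-1 ^ f) v (v^-1 ^ f')).
- exact: comm_displaced Ng gA Du Dv uA vA.
- exact: supported_commute uQ uB dBQ.
- exact: supported_commute uQ vB dBQ.
- exact: supported_commute uQ vP dQP.
- exact: supported_commute vP uB dBP.
- exact: supported_commute vP vB dBP.
Qed.

Context (Ncl : forall (u_ : nat -> Aut mu) u,
  (forall k, N (u_ k)) -> converges T u_ u -> D u -> N u).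

(** From the set [B] of the previous lemma to all small sets [S]. The part of [S]
    that [transport] fails to bring into [B] is removed by inducing, and the
    commutators so obtained converge. *)
Let small_commutators g : N g -> g <> 1 -> exists2 e : R, (0 < e)%R &
  forall S, measurable S -> (mu S <= e%:E)%E -> forall u v, G u -> G v ->
    supported u S -> supported v S -> N [~ u, v].
Proof.
move=> Ng g1; have [B [mB B0 BN]] := local_commutators Ng g1.
have [B1 [mB1 B1B B10 BB10]] := non_atomic_split hmu mB B0.
set B2 := B `\` B1 in BB10; have mB2 : measurable B2 by exact: measurableD.
have fin Y : measurable Y -> mu Y \is a fin_num by exact: fin_num_measure.
pose e : R := Num.min (fine (mu B1) / 2)%R (fine (mu B2) / 2)%R.
have e0 : (0 < e)%R.
  by rewrite lt_min !divr_gt0// fine_gt0// ?B10 ?BB10 -?ge0_fin_numE ?fin.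
exists e => // S mS Se u v Gu Gv uS vS.
(* What is left of [B1] and [B2] outside [S] has to be as large as [S]: hence the
   halves in the choice of [e]. *)
have room Y : measurable Y -> (e <= fine (mu Y) / 2)%R -> (mu S <= mu (Y `\` S))%E.
  move=> mY eY; have : (mu Y <= mu (Y `\` S) + mu S)%E.
    apply: (@le_trans _ _ (mu ((Y `\` S) `|` S))); last first.
      by apply: measureU2 => //; exact: measurableD.
    apply: le_measure; rewrite ?inE//.
      by apply: measurableU => //; exact: measurableD.
    by move=> x Yx; have [|] := pselect (S x); [right|left].
  move: Se; rewrite -(fineK (fin _ mS)) -(fineK (fin _ mY)).
  rewrite -(fineK (fin _ (measurableD mY mS))) -EFinD !lee_fin; lra.
have Q1 : (mu S <= mu (B1 `\` S))%E by apply: room => //; rewrite ge_min lexx.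
have Q2 : (mu S <= mu (B2 `\` S))%E by apply: room => //; rewrite ge_min lexx orbT.
have [h [E [Dh mE muE hE]]] : exists (h : nat -> Aut mu) (E : nat -> set X),
    [/\ forall k, D (h k), forall k, measurable (E k),
      forall r : R, (0 < r)%R -> exists K, forall k, (K <= k)%N -> (mu (E k) < r%:E)%E &
      forall k, {ae mu, forall x, S x -> ~ E k x -> (B1 `\` S) (aut_rep (h k) x)}].
  apply: (transport hX erg mS (measurableD mB1 mS) (measurableD mB2 mS)) => //.
  - by rewrite setDIK.
  - by rewrite setDIK.
  - by apply/seteqP; split=> // x [[B1x _] [[_ nB1x] _]].
have [_ mG iG] := sG.
have approx w : G w -> supported w S -> exists w_ : nat -> Aut mu,
    [/\ forall k, G (w_ k), forall k, supported (w_ k) (S `\` E k) & converges T w_ w].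
  move=> Gw wS.
  have ind k := induced_element hX Gw (mE k).
  have wP k := svalP (cid (ind k)).
  exists (fun k => sval (cid (ind k))); split=> [k|k|r r0].
  - by have [] := wP k.
  - by have [_ w'S _ _] := wP k; exact: w'S.
  have ml : measurable_fun setT (fun x => odist T x (aut_rep w x)).
    apply: (measurable_odist hX T); first exact: measurable_idfun.
    exact: mpfun_measurable.
  have r2 : (0 < r / 2)%R by rewrite divr_gt0.
  have [r' r'0 small] := integral_absolutely_continuous ml (fun=> odist_ge0 _ _ _) Gw r2.
  have [K HK] := muE _ r'0; exists K => k /HK Ek; have [_ _ ww' _] := wP k.
  apply: le_lt_trans ww' _; rewrite (splitr r) EFinD.
  by apply: lteD; exact: small.
have [u_ [Gu_ uE cu]] := approx u Gu uS; have [v_ [Gv_ vE cv]] := approx v Gv vS.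
apply: (Ncl (u_ := fun k => [~ u_ k, v_ k])); last exact: derived_comm.
  move=> k; rewrite -(conjgK (h k)^-1 [~ u_ k, v_ k]) invgK.
  apply: NJ => //; rewrite conjRg.
  have GhV : G (h k)^-1 by apply: iG; exact: DG.
  have inB : {ae mu, forall x, (S `\` E k) (aut_rep (h k)^-1 x) -> B x}.
    apply: filterS2 (ae_mpbij (aut_rep (h k)^-1) (hE k)) (aut_repKV (h k)).
    by move=> x hS hK [Sx nEx]; have [] := hS Sx nEx; rewrite hK => /B1B.
  apply: BN; [exact: subgroup_conj|exact: subgroup_conj| |].
    exact: supportedJ inB (uE k).
  exact: supportedJ inB (vE k).
exact: (converges_comm hX Gu Gv cu cv).
Qed.

(** Elements of small support generate [G], and by the previous lemma any two of
    them commute modulo [N]. *)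
Lemma derived_sub_normal g : N g -> g <> 1 -> D `<=` N.
Proof.
move=> Ng g1; have [e e0 eN] := small_commutators Ng g1.
(* Two supports, each of which comes from a set of the cover and its image. *)
have e4 : (0 < e / 4)%R by rewrite divr_gt0.
have [Es EsP EsT] := small_cover erg hmu e4.
apply: (derived_sub_generators sG sN (P := [set v | G v /\
    exists S, [/\ measurable S, (mu S <= (e / 4 + e / 4)%:E)%E & supported v S]])).
- by move=> u [].
- move=> u Gu; apply: (small_support_generation hX EsP Gu).
  by rewrite EsT; apply: aeW => x /(_ I).
- move=> u w [Gu [S [mS Se uS]]] Gw; split; first exact: subgroup_conj.
  exists (aut_rep w @^-1` S); split; first exact: measurable_mppre.
    by rewrite mpfun_preserving.
  by apply: supportedJ uS; exact: aeW.
- move=> u v [Gu [S [mS Se uS]]] [Gv [S' [mS' S'e vS']]].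
  apply: (eN (S `|` S')) => //; first exact: measurableU.
  + apply: le_trans (measureU2 _ _ _) _ => //.
    apply: le_trans (leeD Se S'e) _; rewrite -EFinD lee_fin; lra.
  + by apply: supportedS uS => x; left.
  + by apply: supportedS vS' => x; right.
Qed.

End NormalSubgroups.

(** * Cocycles, and the two implications *)

Section Cocycles.
Context (d : measure_display) (X : measurableType d) (R : realType)
  (mu : probability X R) (hX : standard_borel R X) (T : mpbij mu)
  (hT : aperiodic T).
Implicit Types (u v w : Aut mu).

Lemma cocycleP u x : zorbit T x (aut_rep u x) ->
  aut_rep u x = zpow T (cocycle T u x) x.
Proof.
move=> [n _ nE]; apply: (@xgetPex _ 0 [set n : int | aut_rep u x = zpow T n x]).
by exists n; rewrite /= nE.
Qed.

Lemma integral_cocycle (c : X -> int) (f g : X -> X) :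
  measurable_fun setT f -> measurable_fun setT g ->
  {ae mu, forall x, odist T (f x) (g x) = ((`|c x|%N)%:R)%:E} ->
  (\int[mu]_x (`|c x|%:~R)%:E)%E = Ldist T f g.
Proof.
move=> mf mg fgc; apply: ge0_integral_ae_measurable.
- by move=> x; rewrite lee_fin ler0z.
- by move=> x; exact: odist_ge0.
- exact: measurable_odist.
- by apply: filterS fgc => x ->; rewrite natr_absz.
Qed.

Lemma L1_dist_full u v : full_group T u -> full_group T v ->
  L1_dist T u v = dst T u v.
Proof.
move=> fu fv; apply: integral_cocycle; [exact: mpfun_measurable|exact: mpfun_measurable|].
apply: filterS3 hT fu fv => x oo /cocycleP -> /cocycleP ->.
by rewrite odist_infinite_orbit.
Qed.

Lemma L1_full_groupE : L1_full_group T = integrable_group T.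
Proof.
have nE u : full_group T u ->
    (\int[mu]_x (`|cocycle T u x|%:~R)%:E)%E = norm T u.
  move=> fu; apply: integral_cocycle; [exact: measurable_idfun|exact: mpfun_measurable|].
  apply: filterS2 hT fu => x oo /cocycleP ->.
  by rewrite (odist_infinite_orbit 0 _ oo) sub0r abszN.
apply/seteqP; split=> u; first by move=> [fu] /=; rewrite nE.
move=> Gu; have fu : full_group T u by exact: norm_zorbit.
by split=> //=; rewrite nE.
Qed.

Lemma L1_dist_dst u v : integrable_group T u -> integrable_group T v ->
  L1_dist T u v = dst T u v.
Proof. by move=> Gu Gv; apply: L1_dist_full; exact: norm_zorbit. Qed.

End Cocycles.

Section ClosedDerivedSubgroup.
Context (d : measure_display) (X : measurableType d) (R : realType)
  (mu : probability X R) (hX : standard_borel R X) (hmu : non_atomic mu)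
  (T : mpbij mu) (hT : aperiodic T).
Implicit Types (u v w g : Aut mu) (A B E S P Q : set X).
Local Open Scope group_scope.

Local Notation G := (integrable_group T).
Local Notation D := (derived_subgroup G).
Local Notation H := (closure_in (L1_dist T) G D).

Let sG : is_subgroup G := integrable_groupP hX T.
Let sD : is_subgroup D := derived_is_subgroup G.
Let DG : D `<=` G := derived_subset sG.

Lemma closure_in_converges (M : set (Aut mu)) x : M `<=` G -> G x ->
  (forall e : R, (0 < e)%R -> exists2 y, (M `&` G) y & (L1_dist T x y < e%:E)%E) <->
  exists2 y_ : nat -> Aut mu, (forall k, M (y_ k)) & converges T y_ x.
Proof.
move=> MG Gx; split=> [cl|[y_ My cy] e /cy[K yK]]; last first.
  exists (y_ K); first by split=> //; exact: MG.
  by rewrite (L1_dist_dst hX hT) ?yK//; exact: MG.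
have ex k : exists2 y, M y & (dst T x y < ((k.+1%:R^-1)%R)%:E)%E.
  have [|y [My Gy]] := cl (k.+1%:R^-1)%R; first by rewrite invr_gt0.
  by rewrite (L1_dist_dst hX hT)// => xy; exists y.
exists (fun k => sval (cid2 (ex k))) => [k|e e0]; first by case: cid2.
have [K Ke] := ltr_add_invr e0; exists K => k Kk; case: cid2 => y _ /= xy.
apply: lt_trans xy _; rewrite lte_fin; apply: le_lt_trans Ke; rewrite add0r.
by rewrite lef_pV2 ?posrE// ler_nat ltnS.
Qed.

Let HP x : H x <-> G x /\ exists2 y_ : nat -> Aut mu, (forall k, D (y_ k)) & converges T y_ x.
Proof.
split=> [[Gx cl]|[Gx cl]]; split=> //.
  by apply/(closure_in_converges DG Gx).
by apply/(closure_in_converges DG Gx).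
Qed.

Let DH : D `<=` H.
Proof.
move=> x Dx; apply/HP; split; first exact: DG.
by exists (fun=> x) => // e e0; exists 0%N => k _; rewrite dstxx.
Qed.

Let sH : is_subgroup H.
Proof.
have [G1 mG iG] := sG; have [D1 mD iD] := sD; split.
- exact: DH.
- move=> x y /HP[Gx [x_ Dx cx]] /HP[Gy [y_ Dy cy]]; apply/HP; split; first exact: mG.
  exists (fun k => x_ k * y_ k) => [k|]; first exact: mD.
  exact: converges_mul.
- move=> x /HP[Gx [x_ Dx cx]]; apply/HP; split; first exact: iG.
  exists (fun k => (x_ k)^-1) => [k|]; first exact: iD.
  exact: converges_inv.
Qed.

Lemma ergodic_topologically_simple : ergodic T -> topologically_simple (L1_dist T) H.
Proof.
move=> erg N [sN NH NJ] Ncl.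
have [[g [Ng g1]]|no] := pselect (exists g, N g /\ g <> 1); [right|left]; last first.
  apply/seteqP; split=> [g Ng|_ ->]; last by have [] := sN.
  by apply: contrapT => g1; apply: no; exists g.
have HG : H `<=` G by move=> x [].
have cl (u_ : nat -> Aut mu) u : (forall k, N (u_ k)) -> converges T u_ u -> H u -> N u.
  move=> Nu cu Hu; apply: Ncl; split=> // e /cu[K uK].
  exists (u_ K); first by split=> //; exact: NH.
  rewrite (L1_dist_dst hX hT) ?uK//; first exact: HG.
  by apply: HG; exact: NH.
have DN : D `<=` N.
  apply: (derived_sub_normal hX hmu erg sN _ _ Ng g1).
    by move=> x y Nx Dy; apply: NJ => //; exact: DH.
  by move=> u_ u Nu cu Du; apply: cl Nu cu _; exact: DH.
apply/seteqP; split=> // x Hx; have /HP[_ [x_ Dx cx]] := Hx.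
by apply: cl _ cx Hx => k; exact: DN.
Qed.

(** Aperiodicity provides a subset of [A] disjoint from its first two translates,
    which stay in [A] by invariance, and so a three-cycle. *)
Let nontrivial_in A : measurable A -> A = \bigcup_(x in A) zorbit T x ->
  (0 < mu A)%E -> exists c, [/\ D c, supported c A & c <> 1].
Proof.
move=> mA Ainv A0.
have moved (n : int) Y : n != 0%R -> measurable Y -> (0 < mu Y)%E ->
    exists B, [/\ measurable B, B `<=` Y, (0 < mu B)%E &
                forall x, B x -> ~ B (zpow T n x)].
  move=> n0 mY Y0; apply: (displaced_subset hX (zpow_measurable T n) mY).
  have mE : measurable [set x | zpow T n x <> x].
    by apply: (measurable_neq hX); [exact: zpow_measurable|exact: measurable_idfun].
  have YE0 : mu (Y `\` [set x | zpow T n x <> x]) = 0%E.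
    apply/(negligibleP mu); first exact: measurableD.
    apply: negligibleS hT => x /= [_ /contrapT nx] /zpow_inj_infinite inj.
    by move/eqP: n0; apply; exact: (inj n 0%R).
  have YE : mu Y = (mu (Y `\` [set x | zpow T n x <> x]) +
                   mu (Y `&` [set x | zpow T n x <> x]))%E by exact: measureDI.
  by move: Y0; rewrite YE YE0 add0e.
have [B1 [mB1 B1A B10 B1T]] := moved 1%R A isT mA A0.
have [B [mB BB1 B0 BT2]] := moved 2%R B1 isT mB1 B10.
have BT x : B x -> ~ B (zpow T 1 x) by move=> /BB1 /B1T nB /BB1.
have BTT x y : B x -> B y -> zpow T 1 x <> zpow T 2 y.
  move=> Bx By; rewrite (zpowD T 1 1 y) => /(can_inj (zpowNK T 1)) xy.
  by apply: BT By _; rewrite -xy.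
have [c Dc cP] := three_cycle hX mB BT BT2 BTT.
have BA : B `<=` A by move=> x /BB1 /B1A.
have Ainv' n x : A (zpow T n x) -> A x.
  move=> An; rewrite Ainv; exists (zpow T n x) => //.
  by exists (- n)%R => //; rewrite zpowNK.
exists c; split=> //.
  apply: filterS cP => x [_ cfix] nAx; apply: cfix.
  - by move=> /BA.
  - by move=> /BA /Ainv'.
  - by move=> /BA /Ainv'.
move=> c1; move: B0; rewrite lt_neqAle eq_sym => /andP[/eqP + _]; apply.
apply/(negligibleP mu mB); move: cP; rewrite c1 => cP.
have [M [mM M0 PM]] := filterI cP (aut_rep1 mu).
exists M; split=> // x Bx; apply: PM => -[[/(_ Bx) c1x _]] /=.
by rewrite c1x => Tx; apply: (BT _ Bx); rewrite Tx.
Qed.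

(** An invariant set [A] that is neither null nor conull yields the closed normal
    subgroup of the elements of [H] supported in [A], which is neither trivial nor
    the whole of [H], by the previous lemma for [A] and for its complement. *)
Lemma topologically_simple_ergodic : topologically_simple (L1_dist T) H -> ergodic T.
Proof.
move=> simple A mA Ainv; apply: contrapT => /not_orP[A0 A1].
have HG : H `<=` G by move=> x [].
have Ain n x : A x -> A (zpow T n x).
  by move=> Ax; rewrite Ainv; exists x => //; exact: zorbit_zpow.
have Ain' n x : A (zpow T n x) -> A x.
  by move=> /(Ain (- n)%R); rewrite zpowNK.
have Aorbit x y : zorbit T x y -> A y -> A x by move=> [n _ <-]; exact: Ain'.
have mCA : measurable (~` A) by exact: measurableC.
have CAinv : ~` A = \bigcup_(x in ~` A) zorbit T x.
  apply/seteqP; split=> [x nAx|y [x nAx [n _ <-]]].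
    by exists x => //; exact: zorbit_refl.
  by move=> /Ain'.
have A0' : (0 < mu A)%E by rewrite lt_neqAle measure_ge0 andbT; apply/eqP/nesym.
have CA0 : (0 < mu (~` A))%E.
  rewrite lt_neqAle measure_ge0 andbT; apply/eqP => CA0; apply: A1.
  by rewrite -[A]setCK probability_setC// -CA0 sube0.
pose N : set (Aut mu) := [set u | H u /\ supported u A].
have [H1 mH iH] := sH.
have sN : is_subgroup N.
  split; first by split=> //; exact: supported1.
  - by move=> x y [Hx xA] [Hy yA]; split; [exact: mH|exact: supportedM].
  - by move=> x [Hx xA]; split; [exact: iH|exact: supportedV].
have nN : normal_subgroup N H.
  split=> //; first by move=> x [].
  move=> x y [Hx xA] Hy; split; first exact: subgroup_conj.
  apply: supportedJ xA; have := norm_zorbit hX (HG _ Hy).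
  by apply: filterS => z; exact: Aorbit.
have cN : closed_in (L1_dist T) H N.
  move=> x [Hx cl]; split=> //.
  have Gx := HG _ Hx.
  pose E := [set z | aut_rep x z <> z] `&` ~` A.
  have mE : measurable E.
    apply: measurableI => //; apply: (measurable_neq hX); last exact: measurable_idfun.
    exact: mpfun_measurable.
  suff E0 : mu E = 0%E.
    by exists E; split=> // z /= /not_implyP[nAz xz]; split.
  apply/eqP; rewrite -measure_le0; apply/lee_addgt0Pr => e e0; rewrite add0e.
  have [y [[Hy yA] _]] := cl _ e0.
  rewrite (L1_dist_dst hX hT)//; last exact: HG.
  move=> /ltW; apply: le_trans.
  have mxy : measurable [set z | aut_rep x z <> aut_rep y z].
    by apply: (measurable_neq hX); exact: mpfun_measurable.
  apply: le_trans (mu_neq_le hX _ _ _); [|exact: mpfun_measurable|exact: mpfun_measurable].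
  have [M [mM M0 yM]] := yA.
  rewrite -[leRHS](measureU0 mxy mM M0).
  apply: le_measure; rewrite ?inE//; first exact: measurableU.
  move=> z [xz nAz]; have [yz|yz] := pselect (aut_rep y z = z).
    by left; rewrite /= yz.
  by right; apply: yM => /= H'; apply: yz; exact: H'.
have [N1|NH] := simple N nN cN.
- have [c [Dc cA c1]] := nontrivial_in mA Ainv A0'.
  have : N c by split=> //; exact: DH.
  by rewrite N1.
- have [c [Dc cA c1]] := nontrivial_in mCA CAinv CA0.
  have : N c by rewrite NH; exact: DH.
  move=> [_ cA']; apply: c1; apply: (supported_set0 (measure0 mu)) => //.
  have cAx : {ae mu, forall x, ~ A x -> aut_rep c x = x} := cA'.
  apply: filterS2 cAx cA => x nA nCA _.
  by have [Ax|] := pselect (A x); [apply: nCA; exact|exact: nA].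
Qed.

End ClosedDerivedSubgroup.

Theorem theorem1p4 (R : realType) (d : measure_display) (X : measurableType d)
    (mu : probability X R) (hX : standard_borel R X) (hmu : non_atomic mu)
    (T : mpbij mu) (hT : aperiodic T) :
  ergodic T <->
  topologically_simple (L1_dist T)
    (closure_in (L1_dist T) (L1_full_group T)
       (derived_subgroup (L1_full_group T))).
Proof.
rewrite (L1_full_groupE hX hT); split.
  exact: ergodic_topologically_simple.
exact: topologically_simple_ergodic.
Qed.
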